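(* Assume that there are no prime number $p$ and integer $N\ge2$ such that $v_p(H_N-1)\ge 4$. Then, for every integer $N\ge 2$, the largest integer $u_N$ such that $$\widetilde q_{(N)}(z)^{1/u_N}\in\mathbb Z[[z]]$$ is $u_N=\Omega_N N!$, where $$\widetilde q_{(N)}(z)=\exp\left(\frac{\sum_{m=1}^\infty (H_{Nm}-H_m)\frac{(Nm)!}{m!^N}z^m}{\sum_{m=0}^\infty \frac{(Nm)!}{m!^N}z^m}\right)$$ and $$\Omega_N:=\prod_{p\le N}p^{\min\{2+\omega(p,N),\,v_p(H_N-1)\}},$$ the product being over all primes $p\le N$, with $\omega(p,N)=1$ if $p$ is a Wolstenholme prime or $N\equiv\pm1\bmod p$, and $\omega(p,N)=0$ otherwise.
   Context: $H_n=\sum_{i=1}^n \frac1i$ is the $n$-th harmonic number. $v_p$ is the $p$-adic valuation on $\mathbb Q$. A prime $p$ is a Wolstenholme prime if $v_p(H_{p-1})\ge 3$. For a power series $q(z)=\exp(g(z))$ with $g(z)\in z\mathbb Q[[z]]$ and a rational number $\alpha$, $q(z)^\alpha$ denotes $\exp(\alpha g(z))$. The sequence $(u_N)$ is called the Dwork--Kontsevich sequence. *)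

(* Defs.v *)
From HB Require Import structures.
From mathcomp Require Import all_boot all_order all_algebra.
Set Implicit Arguments.
Unset Strict Implicit.
Unset Printing Implicit Defensive.
Import Order.TTheory GRing.Theory Num.Theory.
Local Open Scope ring_scope.

(* An element of Q[[z]] is represented by its sequence of coefficients. *)
Definition fps := nat -> rat.

Definition fps_one : fps := fun n => (n == 0%N)%:R.

Definition fps_mul (f g : fps) : fps :=
  fun n => \sum_(i < n.+1) f i * g (n - i)%N.

Definition fps_exp_nat (f : fps) (k : nat) : fps := iter k (fps_mul f) fps_one.

Definition fps_scale (a : rat) (f : fps) : fps := fun n => a * f n.

(* Inverse of a series f with f 0 != 0, by the geometric series
   f^-1 = f_0^-1 * \sum_k h^k with h = 1 - f / f_0.  As h has no constant term,
   h^k contributes to the coefficient of z^n only for k <= n. *)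
Definition fps_inv (f : fps) : fps :=
  let h : fps := fun n => fps_one n - (f 0%N)^-1 * f n in
  fun n => (f 0%N)^-1 * \sum_(k < n.+1) fps_exp_nat h k n.

Definition fps_div (f g : fps) : fps := fps_mul f (fps_inv g).

(* exp(g) = \sum_k g^k / k! for g with g 0 = 0; again g^k contributes to the
   coefficient of z^n only for k <= n. *)
Definition fps_exp (g : fps) : fps :=
  fun n => \sum_(k < n.+1) fps_exp_nat g k n / k`!%:R.

Definition fps_integral (f : fps) : Prop := forall n : nat, f n \is a Num.int.

Definition harmonic (n : nat) : rat := \sum_(1 <= i < n.+1) (i%:R)^-1.

(* The p-adic valuation of a nonzero rational.  (The value at 0 is the junk
   value 0; the valuation is only used below at H_{p-1} > 0 with p prime and at
   H_N - 1 > 0 with N >= 2.) *)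
Definition padic_val (p : nat) (x : rat) : int :=
  (logn p `|numq x|%N)%:Z - (logn p `|denq x|%N)%:Z.

Definition wolstenholme_prime (p : nat) : bool :=
  prime p && (3 <= padic_val p (harmonic p.-1)).

Definition omega (p N : nat) : nat :=
  if [|| wolstenholme_prime p,
         (N%:Z == 1 %[mod p%:Z])%Z | (N%:Z == -1 %[mod p%:Z])%Z]
  then 1%N else 0%N.

(* The exponents may be negative, so Omega is a rational number. *)
Definition Omega (N : nat) : rat :=
  \prod_(p < N.+1 | prime p)
     (p%:R : rat) ^ Num.min (2 + (omega p N)%:Z) (padic_val p (harmonic N - 1)).

Definition multinom_coef (N m : nat) : rat := (N * m)`!%:R / m`!%:R ^+ N.

Definition mirror_F (N : nat) : fps := fun m => multinom_coef N m.

(* The term m = 0 vanishes because H_0 - H_0 = 0. *)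
Definition mirror_G (N : nat) : fps :=
  fun m => (harmonic (N * m) - harmonic m) * multinom_coef N m.

Definition mirror_log (N : nat) : fps := fps_div (mirror_G N) (mirror_F N).

Definition qtilde (N : nat) : fps := fps_exp (mirror_log N).

(* The power q^a of q = exp(g) is by definition exp(a g). *)
Definition qtilde_pow (N : nat) (a : rat) : fps :=
  fps_exp (fps_scale a (mirror_log N)).

Definition is_largest_int (P : int -> Prop) (u : int) : Prop :=
  P u /\ forall w : int, P w -> w <= u.

Lemma fps_exp_nat_small (h : fps) (k n : nat) :
  h 0%N = 0 -> (n < k)%N -> fps_exp_nat h k n = 0.
Proof.
move=> h0; elim: k n => [|k IHk] n // ltnk.
rewrite /fps_exp_nat /= /fps_mul big1 // => -[[|i] lti] _ /=.
  by rewrite h0 mul0r.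
have -> : iter k (fps_mul h) fps_one (n - i.+1)%N = 0; last by rewrite mulr0.
apply: IHk; apply: (@leq_trans n) => //.
by rewrite ltn_subrL (leq_trans _ (lti : (i.+1 <= n)%N)).
Qed.

Lemma fps_mulV (f : fps) : f 0%N != 0 -> fps_mul f (fps_inv f) =1 fps_one.
Proof.
move=> f0 n; pose h : fps := fun n => fps_one n - (f 0%N)^-1 * f n.
have h0 : h 0%N = 0 by rewrite /h /fps_one /= mulVf // subrr.
have fE i : f i = f 0%N * (fps_one i - h i).
  by rewrite /h subKr mulrA mulfV // mul1r.
have invE i : (i <= n)%N ->
    fps_inv f i = (f 0%N)^-1 * \sum_(k < n.+1) fps_exp_nat h k i.
  move=> lein; rewrite /fps_inv -/h; congr (_ * _).
  rewrite (big_ord_widen n.+1 (fun k => fps_exp_nat h k i)) ?ltnS //.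
  rewrite big_mkcond; apply: eq_bigr => k _.
  by rewrite ltnS; case: leqP => // ltik; rewrite fps_exp_nat_small.
have one_mul (g : fps) : \sum_(i < n.+1) fps_one i * g (n - i)%N = g n.
  rewrite big_ord_recl /fps_one /= mul1r subn0 big1 ?addr0 // => i _.
  by rewrite mul0r.
transitivity (\sum_(k < n.+1) (fps_exp_nat h k n - fps_exp_nat h k.+1 n)).
  transitivity (\sum_(i < n.+1) \sum_(k < n.+1)
     (fps_one i - h i) * fps_exp_nat h k (n - i)%N).
    apply: eq_bigr => i _.
    rewrite (invE _ (leq_subr _ _)) fE -mulrA [X in _ * X]mulrCA !mulrA.
    by rewrite mulfV // mul1r mulr_sumr.
  rewrite exchange_big; apply: eq_bigr => k _ /=.
  under eq_bigr do rewrite mulrBl.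
  by rewrite sumrB one_mul.
rewrite sumrB big_ord_recl [X in _ - X]big_ord_recr /=.
have -> : fps_mul h (fps_exp_nat h n) n = 0.
  exact: (@fps_exp_nat_small h n.+1 n).
by rewrite addr0 addrK.
Qed.

Lemma qtilde_pow1 (N : nat) : qtilde_pow N 1 =1 qtilde N.
Proof.
move=> n; apply: eq_bigr => k _; congr (_ / _).
rewrite /fps_exp_nat; move: (k : nat) => {}k.
elim: k n => //= j IHj n.
by apply: eq_bigr => i _; rewrite IHj /fps_scale mul1r.
Qed.

(* Main.v *)
Require Import Defs.
From HB Require Import structures.
From mathcomp Require Import all_boot all_order all_algebra.
From mathcomp Require Import ring lra zify.
From mathcomp Require boolp.
Set Implicit Arguments.
Unset Strict Implicit.
Unset Printing Implicit Defensive.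
Import Order.TTheory GRing.Theory Num.Theory.
Local Open Scope ring_scope.

(* Let [F = sum B(m) z^m] and [G = sum h(m) B(m) z^m] with
   [B(m) = (N m)! / m!^N] and [h(m) = H_{N m} - H_m].  By Dwork's lemma
   [exp(G / (c F))] has [p]-integral coefficients iff the coefficients of
   [F(z) G(z^p) - p F(z^p) G(z)] lie in [p c Z_(p)].

   Dwork's congruences for the sums of [B(a+jp) B(K-j) - B(j) B(a+(K-j)p)] over
   [m p^s <= j < (m+1) p^s] and a summation by parts reduce membership in
   [p^(1+t) N! Z_(p)] to the two statements
   [B(m) (p h(m) - h(m %/ p))] in [p^(1+t) N! Z_(p)] and
   [p h(p m) - h(m)] in [p^(1+t) Z_(p)].  For [p >= 5] the latter follows from
   [p h(p m) - h(m) = p m^2 (N^2 - 1) H_{p-1}] modulo [p^4] and Wolstenholme's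
   theorem; this is where [omega(p, N)] comes from.  For [m = 1] the former is
   the valuation of [H_N - 1] itself, and for other [m] prime to [p] it holds
   because [1 + t <= N %/ p], which needs an argument only for the few [N] with
   [N %/ p <= 3].  The primes 2 and 3, where Wolstenholme's theorem fails, are
   harmless because [v_2(H_N - 1) < 0] and [v_3(H_N - 1) <= 1].

   Conversely, the coefficient of [z] bounds the exponent by [v_p(H_N - 1)], the
   coefficient of [z^p] bounds it by [2 + omega(p, N)] if [v_p(H_N - 1) = 3],
   and the coefficient of [z^(p %/ N + 1)] excludes the primes [p > N]. *)

(** * Localization of the rationals at a prime *)

Definition zloc (p : nat) : {pred rat} := [pred x | coprime p `|denq x|%N].

(** The reduced denominator divides every other denominator, so any denominator prime to [p] is as
    good a witness. *)
Lemma zlocP (p : nat) (x : rat) :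
  reflect (exists2 d : nat, coprime p d & x * d%:R \is a Num.int) (x \in zloc p).
Proof.
apply: (iffP idP) => [px | [d pd /intrP [a xd]]].
  exists `|denq x|%N => //.
  rewrite -[X in _ * X]/((`|denq x|%N%:Z)%:~R) absz_denq -numqE.
  exact: intr_int.
rewrite inE; apply: coprime_dvdr pd.
have : (numq x * d%:Z)%:~R = (a * denq x)%:~R :> rat.
  by rewrite !rmorphM /= -xd numqE mulrAC.
move/intr_inj/(congr1 absz); rewrite !abszM absz_nat => E.
have : (`|denq x| %| `|numq x| * d)%N by rewrite E dvdn_mull.
by rewrite Gauss_dvdr // coprime_sym coprime_num_den.
Qed.

Lemma zloc_subring_closed (p : nat) : subring_closed (zloc p).
Proof.
split=> [|x y /zlocP[d pd xd] /zlocP[e pe ye]|x y /zlocP[d pd xd] /zlocP[e pe ye]].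
- by apply/zlocP; exists 1%N; rewrite ?coprimen1.
- apply/zlocP; exists (d * e)%N; rewrite ?coprimeMr ?pd // natrM mulrBl.
  rewrite rpredB //; first by rewrite mulrA rpredM // natr_int.
  by rewrite [d%:R * _]mulrC mulrA rpredM // natr_int.
apply/zlocP; exists (d * e)%N; rewrite ?coprimeMr ?pd // natrM mulrACA.
by rewrite rpredM.
Qed.

HB.instance Definition _ (p : nat) :=
  GRing.isSubringClosed.Build rat (zloc p) (zloc_subring_closed p).

Lemma zloc_int (p : nat) (z : int) : z%:~R \in zloc p.
Proof. by apply/zlocP; exists 1%N; rewrite ?coprimen1 // mulr1 intr_int. Qed.

Lemma zloc_nat (p n : nat) : n%:R \in zloc p.
Proof. exact: rpred_nat. Qed.

Lemma zlocV_nat (p n : nat) : coprime p n -> (n%:R)^-1 \in zloc p.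
Proof.
move=> pn; apply/zlocP; exists n => //.
have [->|n0] := eqVneq (n%:R : rat) 0; first by rewrite mulr0.
by rewrite mulVf.
Qed.

Lemma zloc_all (x : rat) : (forall p, prime p -> x \in zloc p) -> x \is a Num.int.
Proof.
move=> h; have d1 : `|denq x|%N = 1%N.
  apply/eqP; apply: contraT => d1.
  have d2 : (1 < `|denq x|)%N by rewrite ltn_neqAle eq_sym d1 absz_gt0 denq_neq0.
  have := h _ (pdiv_prime d2); rewrite inE prime_coprime ?pdiv_prime //.
  by rewrite pdiv_dvd.
apply/intrP; exists (numq x); rewrite numqE.
by rewrite -absz_denq d1 mulr1.
Qed.

(* [zid p y] is the fractional ideal [y Z_(p)]; for [y = 0] it is, because of
   [x / 0 = 0], all of Q. *)
Definition zid (p : nat) (y : rat) : {pred rat} := [pred x | x / y \in zloc p].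

Lemma zidE (p : nat) (y x : rat) : (x \in zid p y) = (x / y \in zloc p).
Proof. by []. Qed.

Lemma zid_zmod_closed (p : nat) (y : rat) : zmod_closed (zid p y).
Proof.
split; first by rewrite zidE mul0r rpred0.
by move=> u v; rewrite !zidE mulrBl => *; rewrite rpredB.
Qed.

HB.instance Definition _ (p : nat) (y : rat) :=
  GRing.isZmodClosed.Build rat (zid p y) (zid_zmod_closed p y).

Lemma zid1 (p : nat) : zid p 1 =i zloc p.
Proof. by move=> x; rewrite zidE divr1. Qed.

Lemma zidM (p : nat) (y z u v : rat) :
  u \in zid p y -> v \in zid p z -> u * v \in zid p (y * z).
Proof. by rewrite !zidE invfM mulrACA; apply: rpredM. Qed.

Lemma zidMr (p : nat) (y u v : rat) :
  u \in zid p y -> v \in zloc p -> u * v \in zid p y.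
Proof. by rewrite !zidE mulrAC; apply: rpredM. Qed.

Lemma zidMl (p : nat) (y u v : rat) :
  u \in zloc p -> v \in zid p y -> u * v \in zid p y.
Proof. by rewrite !zidE -mulrA; apply: rpredM. Qed.

Lemma zid_self (p : nat) (y : rat) : y \in zid p y.
Proof.
rewrite zidE; have [->|y0] := eqVneq y 0; first by rewrite mul0r rpred0.
by rewrite divff ?rpred1.
Qed.

Lemma zid_mulr (p : nat) (y u : rat) : u \in zloc p -> y * u \in zid p y.
Proof. by move=> ?; apply: zidMr (zid_self p y) _. Qed.

Lemma zid_mull (p : nat) (y u : rat) : u \in zloc p -> u * y \in zid p y.
Proof. by rewrite mulrC; apply: zid_mulr. Qed.

Lemma zid_trans (p : nat) (y z x : rat) :
  y != 0 -> x \in zid p y -> y \in zid p z -> x \in zid p z.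
Proof.
rewrite !zidE => y0 h1 h2; have := rpredM h1 h2.
by rewrite mulrA divfK.
Qed.

Lemma zid_mul2l (p : nat) (c y x : rat) :
  c != 0 -> (c * x \in zid p (c * y)) = (x \in zid p y).
Proof. by move=> c0; rewrite !zidE -mulf_div divff // mul1r. Qed.

Lemma zid_mulrI (p : nat) (c y x : rat) :
  c != 0 -> c^-1 \in zloc p -> x * c \in zid p y -> x \in zid p y.
Proof.
move=> c0 ci h; rewrite -(mulfK c0 x); exact: zidMr.
Qed.

Lemma zid_zloc (p : nat) (y x : rat) :
  y != 0 -> y \in zloc p -> x \in zid p y -> x \in zloc p.
Proof. by move=> y0 py xy; rewrite -zid1; apply: zid_trans y0 xy _; rewrite zid1. Qed.

Lemma zid_exp (p k l : nat) (x : rat) : (0 < p)%N ->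
  (l <= k)%N -> x \in zid p (p%:R ^+ k) -> x \in zid p (p%:R ^+ l).
Proof.
move=> p0 lk xk; apply: zid_trans xk _; first by rewrite expf_neq0 // pnatr_eq0 -lt0n.
by rewrite -(subnK lk) exprD zid_mull // rpredX // zloc_nat.
Qed.

(** [Z_(p)] is a valuation ring: if [p] does not divide the numerator, the numerator is a
    denominator of the inverse. This replaces valuations in the arguments by contradiction. *)
Lemma zloc_total (p : nat) (x : rat) : prime p ->
  (x \in zid p p%:R) || (x^-1 \in zloc p).
Proof.
move=> pp; have [-> | x0] := eqVneq x 0; first by rewrite rpred0.
have pr0 : (p%:R : rat) != 0 by rewrite pnatr_eq0 -lt0n prime_gt0.
have [pn | pn] := boolP (p %| `|numq x|)%N; last first.
  apply/orP; right; apply/zlocP; exists `|numq x|%N; first by rewrite prime_coprime.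
  have -> : `|numq x|%N%:R = (-1) ^+ (numq x < 0)%R * (numq x)%:~R :> rat.
    rewrite -[LHS]/((`|numq x|%N%:Z)%:~R) abszE normrEsign rmorphM /=.
    by rewrite rmorph_sign.
  by rewrite numqE mulrCA mulKf // rpredM ?intr_int // rpredX // rpredN rpred1.
apply/orP; left; rewrite zidE; apply/zlocP; exists `|denq x|%N.
  rewrite prime_coprime //; apply/negP => pd.
  have := coprime_num_den x; rewrite /coprime => /eqP g1.
  by have := dvdn_gcd p `|numq x| `|denq x|; rewrite pn pd g1 dvdn1 => /eqP E; rewrite E in pp.
rewrite -[X in _ * X]/((`|denq x|%N%:Z)%:~R) absz_denq mulrAC -numqE.
have /dvdzP[q ->] : (p%:Z %| numq x)%Z by rewrite dvdzE.
by rewrite rmorphM /= -[p%:~R]/(p%:R) mulfK // intr_int.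
Qed.

(** * The ring of formal power series *)

(** Series are bare functions, so decidable equality and choice are taken from classical logic, and
    extensionality gives the ring laws as equations. *)
HB.instance Definition _ := boolp.gen_eqMixin fps.
HB.instance Definition _ := boolp.gen_choiceMixin fps.

Lemma fpsP (f g : fps) : f =1 g -> f = g.
Proof. exact: boolp.funext. Qed.

Definition fps_add (f g : fps) : fps := fun n => f n + g n.
Definition fps_opp (f : fps) : fps := fun n => - f n.
Definition fps_zero : fps := fun=> 0.

Lemma fps_addA : associative fps_add.
Proof. by move=> f g h; apply: fpsP => n; apply: addrA. Qed.
Lemma fps_addC : commutative fps_add.
Proof. by move=> f g; apply: fpsP => n; apply: addrC. Qed.
Lemma fps_add0 : left_id fps_zero fps_add.
Proof. by move=> f; apply: fpsP => n; apply: add0r. Qed.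
Lemma fps_addN : left_inverse fps_zero fps_opp fps_add.
Proof. by move=> f; apply: fpsP => n; apply: addNr. Qed.

HB.instance Definition _ :=
  GRing.isZmodule.Build fps fps_addA fps_addC fps_add0 fps_addN.

Definition fps_trunc (N : nat) (f : fps) : {poly rat} := \poly_(i < N.+1) f i.

Lemma coef_fps_trunc N f n : (n <= N)%N -> (fps_trunc N f)`_n = f n.
Proof. by move=> nN; rewrite coef_poly ltnS nN. Qed.

(** A coefficient of a product depends on finitely many coefficients; commutativity and
    associativity are thus inherited from polynomials. *)
Lemma fps_mul_trunc N (f g : fps) (P Q : {poly rat}) n :
  (forall i, (i <= n)%N -> f i = P`_i) -> (forall i, (i <= n)%N -> g i = Q`_i) ->
  (n <= N)%N -> fps_mul f g n = (P * Q)`_n.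
Proof.
move=> fP gQ nN; rewrite coefM; apply: eq_bigr => i _.
by rewrite fP ?gQ ?leq_subr // -ltnS.
Qed.

Lemma fps_mulC : commutative fps_mul.
Proof.
move=> f g; apply: fpsP => n.
rewrite (@fps_mul_trunc n _ _ (fps_trunc n f) (fps_trunc n g)) //;
  try by move=> i le; rewrite coef_fps_trunc.
rewrite mulrC (@fps_mul_trunc n _ _ (fps_trunc n g) (fps_trunc n f)) //;
  by move=> i le; rewrite coef_fps_trunc.
Qed.

Lemma fps_mulA : associative fps_mul.
Proof.
move=> f g h; apply: fpsP => n.
have E u i : (i <= n)%N -> u i = (fps_trunc n u)`_i by move=> ?; rewrite coef_fps_trunc.
have EM u v i : (i <= n)%N -> fps_mul u v i = (fps_trunc n u * fps_trunc n v)`_i.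
  move=> le; apply: (@fps_mul_trunc n) => // j lj; apply: E; exact: leq_trans le.
rewrite (@fps_mul_trunc n _ _ (fps_trunc n f) (fps_trunc n g * fps_trunc n h)) //; [|exact: E|exact: EM].
rewrite mulrA; symmetry; apply: (@fps_mul_trunc n) => //; [exact: EM|exact: E].
Qed.

Lemma fps_mul1 : left_id fps_one fps_mul.
Proof.
move=> f; apply: fpsP => n; rewrite /fps_mul big_ord_recl /fps_one /= mul1r subn0.
by rewrite big1 ?addr0 // => i _; rewrite mul0r.
Qed.

Lemma fps_mulDl : left_distributive fps_mul fps_add.
Proof.
move=> f g h; apply: fpsP => n; rewrite /fps_mul /fps_add -big_split /=.
by apply: eq_bigr => i _; rewrite mulrDl.
Qed.

Lemma fps_one_neq0 : fps_one != 0 :> fps.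
Proof. by apply/eqP => /(congr1 (fun f : fps => f 0%N)) /eqP; rewrite oner_eq0. Qed.

HB.instance Definition _ :=
  GRing.Zmodule_isComNzRing.Build fps fps_mulA fps_mulC fps_mul1 fps_mulDl fps_one_neq0.

Lemma fps_coefD (f g : fps) n : (f + g) n = f n + g n. Proof. by []. Qed.
Lemma fps_coefB (f g : fps) n : (f - g) n = f n - g n. Proof. by []. Qed.
Lemma fps_coef1 n : (1 : fps) n = (n == 0%N)%:R. Proof. by []. Qed.
Lemma fps_coefM (f g : fps) n : (f * g) n = \sum_(i < n.+1) f i * g (n - i)%N.
Proof. by []. Qed.
Lemma fps_coefMn (f : fps) k n : (f *+ k) n = f n *+ k.
Proof. by elim: k => // k IH; rewrite !mulrS fps_coefD IH. Qed.

Lemma fps_exp_natE (f : fps) k : fps_exp_nat f k = f ^+ k.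
Proof. by elim: k => // k IH; rewrite exprS -IH. Qed.

(** * The Euler derivation [z d/dz] and the exponential series *)

Definition theta (f : fps) : fps := fun n => n%:R * f n.

Lemma thetaD (f g : fps) : theta (f + g) = theta f + theta g.
Proof. by apply: fpsP => n; apply: mulrDr. Qed.

Lemma thetaM (f g : fps) : theta (f * g) = theta f * g + f * theta g.
Proof.
apply: fpsP => n; rewrite fps_coefD /theta !fps_coefM mulr_sumr -big_split /=.
apply: eq_bigr => i _; have le : (i <= n)%N by rewrite -ltnS.
rewrite -{1}(subnKC le) natrD; ring.
Qed.

Lemma theta1 : theta 1 = 0.
Proof. by apply: fpsP => -[|n]; rewrite /theta fps_coef1 ?mul0r ?mulr0. Qed.

Lemma thetaX (f : fps) k : theta (f ^+ k.+1) = (f ^+ k * theta f) *+ k.+1.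
Proof.
elim: k => [|k IH]; first by rewrite expr1 expr0 mul1r.
rewrite exprS thetaM IH [RHS]mulrS exprS; ring.
Qed.

Lemma theta_exp (g : fps) : g 0%N = 0 -> theta (fps_exp g) = theta g * fps_exp g.
Proof.
move=> g0; apply: fpsP => n; rewrite mulrC.
case: n => [|n]; first by rewrite fps_coefM big_ord1 /theta !mul0r mulr0.
(* The bound in [fps_exp] varies with the coefficient. Since [g ^+ k] starts at order [k], one
   common bound serves all [i <= n], which allows the sums to be exchanged. *)
have E i : (i <= n)%N -> fps_exp g i = \sum_(k < n.+1) (g ^+ k) i / k`!%:R.
  move=> le; rewrite /fps_exp (big_ord_widen n.+1 (fun k => fps_exp_nat g k i / k`!%:R)) // big_mkcond.
  apply: eq_bigr => k _; rewrite -fps_exp_natE; case: ifP => // /negbT.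
  by rewrite -leqNgt => lk; rewrite fps_exp_nat_small ?mul0r.
transitivity (\sum_(k < n.+1) (g ^+ k * theta g) n.+1 / k`!%:R).
  rewrite /theta /fps_exp mulr_sumr big_ord_recl (_ : fps_exp_nat g _ _ = 0) // !mul0r mulr0 add0r.
  apply: eq_bigr => k _; rewrite lift0 fps_exp_natE.
  have := congr1 (fun f : fps => f n.+1) (thetaX g k); rewrite fps_coefMn /theta => E1.
  rewrite mulrA {}E1 factS natrM -mulr_natl.
  have k0 : (k.+1%:R : rat) != 0 by rewrite pnatr_eq0.
  have k1 : (k`!%:R : rat) != 0 by rewrite pnatr_eq0 -lt0n fact_gt0.
  by field; rewrite k1 -natr1 addrC in k0 *.
under eq_bigr do rewrite fps_coefM mulr_suml.
rewrite exchange_big fps_coefM /= [LHS]big_ord_recr [RHS]big_ord_recr /= subnn.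
rewrite /theta !mul0r !mulr0 !addr0.
rewrite [X in _ + X = _]big1 ?addr0; last by move=> k _; rewrite mulr0 mul0r.
apply: eq_bigr => i _; rewrite (E i (leq_ord i)) mulr_suml.
by apply: eq_bigr => k _; rewrite mulrAC.
Qed.

Lemma fps_exp0 (g : fps) : fps_exp g 0%N = 1.
Proof. by rewrite /fps_exp big_ord1 divr1. Qed.

(** * The substitution of [z^p] for [z] *)

Definition fps_subst (p : nat) (f : fps) : fps :=
  fun n => if (p %| n)%N then f (n %/ p)%N else 0.

Lemma fps_coefM_subst (p : nat) (f g : fps) (a K : nat) : (a < p)%N ->
  (f * fps_subst p g) (a + K * p)%N = \sum_(j < K.+1) f (a + j * p)%N * g (K - j)%N.
Proof.
move=> ap; have p0 : (0 < p)%N by apply: leq_trans ap.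
rewrite mulrC fps_coefM -(big_mkord xpredT (fun i => fps_subst p g i * f (a + K * p - i)%N)).
transitivity (\sum_(0 <= i < K.+1) g i * f (a + (K - i) * p)%N); last first.
  rewrite big_mkord (reindex_inj rev_ord_inj) /=; apply: eq_bigr => i _.
  by rewrite mulrC subSS subKn // leq_ord.
rewrite (bigID (dvdn p)) /= [X in _ + X]big1 ?addr0; last first.
  by move=> i /negbTE; rewrite /fps_subst => ->; rewrite mul0r.
(* The remainder [b] is left free because the induction step uses [b = p.-1], the end of the
   preceding block. *)
have lem M b : (b < p)%N -> \sum_(0 <= i < (b + M * p).+1 | (p %| i)%N) fps_subst p g i * f (a + K * p - i)%N =
   \sum_(0 <= i < M.+1) g i * f (a + K * p - i * p)%N.
  elim: M b => [|M IHM] b bp.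
    rewrite mul0n addn0 big_ltn_cond // dvdn0 big_nat1 big_nat_cond big1 ?addr0.
      by rewrite /fps_subst dvdn0 div0n.
    move=> i /andP[/andP[i0 ib] pi]; have := dvdn_leq i0 pi; lia.
  have := IHM p.-1; rewrite -addSn prednK // => /(_ (leqnn p)) IHp.
  rewrite big_nat_recr //= -IHp.
  rewrite (@big_cat_nat _ _ _ (p + M * p)%N) //=; last by lia.
  congr (_ + _).
  rewrite big_ltn_cond; last by lia.
  rewrite -mulSn dvdn_mull // big_nat_cond big1 ?addr0.
    by rewrite /fps_subst dvdn_mull // mulnK.
  move=> i /andP[/andP[i0 ib] /dvdnP[q E]].
  have : (M.+1 * p < q * p)%N by lia.
  by rewrite ltn_pmul2r // => lq; have := leq_mul lq (leqnn p); lia.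
rewrite lem //; apply: eq_big_nat => i /andP[_ iK].
by rewrite mulnBl addnBA // leq_mul2r -ltnS iK orbT.
Qed.

Lemma fps_substM (p : nat) (f g : fps) : (0 < p)%N ->
  fps_subst p (f * g) = fps_subst p f * fps_subst p g.
Proof.
move=> p0; apply: fpsP => n; rewrite {2}(divn_eq n p) addnC fps_coefM_subst ?ltn_pmod //.
rewrite {1}/fps_subst /dvdn; case: eqP => [n0 | /eqP n0].
  by rewrite n0; apply: eq_bigr => i _; rewrite /fps_subst add0n dvdn_mull // mulnK.
rewrite big1 // => i _; rewrite /fps_subst dvdn_addl ?dvdn_mull //.
by rewrite /dvdn modn_mod (negbTE n0) mul0r.
Qed.

(** * Dwork's integrality lemma *)

Lemma zloc_fermat (p : nat) (a : rat) : prime p -> a \in zloc p ->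
  a ^+ p - a \in zid p p%:R.
Proof.
move=> pp ap; have p1 := prime_gt1 pp.
have natF (n : nat) : n%:R ^+ p - n%:R \in zid p p%:R.
  have le : (n <= n ^ p)%N.
    by case: n => // n; have := @leq_pexp2l n.+1 1 p isT (prime_gt0 pp); rewrite expn1.
  have := fermat_little n pp => /eqP; rewrite eqn_mod_dvd // => /dvdnP[q E].
  by rewrite -natrX -natrB // E natrM zid_mull // zloc_nat.
have intF (z : int) : z%:~R ^+ p - z%:~R \in zid p p%:R.
  case: (intP z) => [|n|n]; [exact: (natF 0%N)|exact: (natF n.+1)|].
  rewrite rmorphN /= -[n.+1%:~R]/(n.+1%:R).
  have xp := zloc_nat p n.+1; move: (n.+1%:R) (natF n.+1) xp => x xF xp.
  have [p2 | podd] := even_prime pp.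
    have -> : (- x) ^+ p - - x = (x ^+ p - x) + p%:R * x by rewrite p2; ring.
    by rewrite rpredD // zid_mulr.
  by rewrite exprNn -signr_odd podd expr1 mulN1r -opprD rpredN.
have [d pd /intrP[z E]] := zlocP _ _ ap.
have d0 : (d%:R : rat) != 0.
  rewrite pnatr_eq0; apply: contraTneq pd => ->.
  by rewrite /coprime gcdn0 neq_ltn p1 orbT.
(* With [a = z / d], the difference for [a] is expressed through those for the integers [z] and
   [d]. *)
have -> : a ^+ p - a =
    ((z%:~R ^+ p - z%:~R) * d%:R - z%:~R * (d%:R ^+ p - d%:R)) * d%:R^-1 ^+ p.+1.
  rewrite -E exprMn exprSr exprVn; field.
  by rewrite d0 expf_neq0.
apply: zidMr; last by rewrite rpredX // zlocV_nat.
rewrite rpredB //; first exact: zidMr (zloc_nat _ _).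
by apply: zidMl => //; apply: zloc_int.
Qed.

(** In [y^p - z^p = (y - z) * sum], the [p] terms of the sum are all congruent to [z^(p-1)] modulo
    [p], which yields one more factor [p]. *)
Lemma zid_expr_lift (p k : nat) (y z : rat) : prime p -> (0 < k)%N ->
  y \in zloc p -> z \in zloc p -> y - z \in zid p (p%:R ^+ k) ->
  y ^+ p - z ^+ p \in zid p (p%:R ^+ k.+1).
Proof.
move=> pp k0 yp zp yz; rewrite subrXX exprSr; apply: zidM => //.
have yz1 : y - z \in zid p p%:R.
  by apply: (@zid_exp p k 1) => //; apply: prime_gt0.
have -> : \sum_(i < p) y ^+ (p.-1 - i) * z ^+ i =
    p%:R * z ^+ p.-1 + \sum_(i < p) (y ^+ (p.-1 - i) - z ^+ (p.-1 - i)) * z ^+ i.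
  rewrite -[X in X%:R * _]card_ord mulr_natl -sumr_const -big_split /=.
  apply: eq_bigr => i _; rewrite mulrBl -exprD subnK; first by rewrite addrC subrK.
  by rewrite -ltnS prednK ?prime_gt0.
rewrite rpredD //; first by rewrite zid_mulr // rpredX.
apply: rpred_sum => i _; apply: zidMr; last by rewrite rpredX.
rewrite subrXX; apply: zidMr => //; apply: rpred_sum => j _.
by rewrite rpredM ?rpredX.
Qed.

Lemma zid_nat (p k : nat) : prime p -> (0 < k)%N ->
  zid p k%:R =i zid p (p%:R ^+ logn p k).
Proof.
move=> pp k0 x; have E : k%:R = p%:R ^+ logn p k * (k %/ p ^ logn p k)%:R :> rat.
  by rewrite -natrX -natrM mulnC divnK // pfactor_dvdnn.
have r0 : (k %/ p ^ logn p k)%:R != 0 :> rat.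
  by apply: contraTneq k0 => r0; move/eqP: E; rewrite r0 mulr0 pnatr_eq0 => /eqP ->.
have pV : (k %/ p ^ logn p k)%:R^-1 \in zloc p.
  apply: zlocV_nat; rewrite prime_coprime //.
  have := pfactor_coprime pp k0 => -[m pm Em]; rewrite {1}Em mulnK ?expn_gt0 ?prime_gt0 //.
  by rewrite -prime_coprime.
have kU : (p%:R ^+ logn p k)^-1 = k%:R^-1 * (k %/ p ^ logn p k)%:R :> rat.
  by rewrite E invfM -mulrA mulVf ?mulr1.
rewrite !zidE kU; apply/idP/idP => h; first by rewrite mulrA rpredM // zloc_nat.
by have := rpredM h pV; rewrite -!mulrA mulfV // mulr1.
Qed.

(** Only the [p]-part of [k] matters in the modulus; Fermat's congruence is lifted through its
    powers of [p]. *)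
Lemma zloc_fermat_pow (p k : nat) (a : rat) : prime p -> a \in zloc p ->
  (p %| k)%N -> (0 < k)%N -> a ^+ k - a ^+ (k %/ p) \in zid p k%:R.
Proof.
move=> pp ap pk k0; have p0 := prime_gt0 pp.
have L (w : nat) (b : rat) : b \in zloc p ->
    b ^+ (p ^ w.+1) - b ^+ (p ^ w) \in zid p (p%:R ^+ w.+1).
  move=> bp; elim: w => [|w IH]; first by rewrite expn1 expr1; apply: zloc_fermat.
  rewrite [X in b ^+ X - _]expnSr [X in _ - b ^+ X]expnSr !exprM.
  by apply: zid_expr_lift => //; rewrite rpredX.
have [m pm Em] := pfactor_coprime pp k0; rewrite zid_nat //.
have : (0 < logn p k)%N by rewrite logn_gt0 mem_primes pp k0 pk.
case: (logn p k) Em => // w Em _.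
rewrite Em [X in (_ * X %/ p)%N]expnSr mulnA mulnK // !exprM.
by apply: L; rewrite rpredX.
Qed.

(** The Gauss congruences [c(n) = c(n/p)] modulo [n Z_(p)], with [c(n/p)] read as 0 if [p] does not
    divide [n]. At [n = 0] the condition is void, as [zid p 0] is all of Q. *)
Definition gauss (p : nat) (c : fps) : Prop :=
  forall n, c n - fps_subst p c n \in zid p n%:R.

Lemma theta_coef0 (c f : fps) : f 0%N = 1 -> c * f = theta f -> c 0%N = 0.
Proof.
move=> f0 /(congr1 (fun h : fps => h 0%N)).
by rewrite fps_coefM big_ord1 f0 mulr1 /theta mul0r.
Qed.

Lemma theta_coefS (c f : fps) n : f 0%N = 1 -> c * f = theta f ->
  c n = n%:R * f n - \sum_(i < n) c i * f (n - i)%N.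
Proof.
move=> f0 /(congr1 (fun h : fps => h n)).
by rewrite fps_coefM big_ord_recr /= subnn f0 mulr1 /theta => <-; rewrite addrC addrK.
Qed.

Lemma theta_coef_unique (c f c' f' : fps) n : f 0%N = 1 ->
  c * f = theta f -> c' * f' = theta f' -> (forall i, (i <= n)%N -> f i = f' i) ->
  c n = c' n.
Proof.
move=> f0 cf cf'; elim/ltn_ind: n => n IH ff'.
rewrite (theta_coefS _ f0 cf) (theta_coefS _ _ cf') -?ff' //.
congr (_ - _); apply: eq_bigr => i _; rewrite -ff' ?leq_subr //.
by rewrite (IH i) // => j ji; apply: ff'; apply: leq_trans ji _; apply: ltnW.
Qed.

Definition fps_mono (b : rat) (m : nat) : fps := fun n => if n == m then b else 0.

(** The geometric series of [1 / (1 + b z^m)]. *)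
Definition fps_geom (b : rat) (m : nat) : fps :=
  fun n => if (m %| n)%N then (- b) ^+ (n %/ m) else 0.

Lemma fps_coef_monoM (b : rat) (m : nat) (f : fps) n :
  (fps_mono b m * f) n = if (m <= n)%N then b * f (n - m)%N else 0.
Proof.
rewrite fps_coefM /fps_mono; case: leqP => mn.
  rewrite (bigD1 (Ordinal (mn : (m < n.+1)%N))) //= eqxx big1 ?addr0 // => i.
  by rewrite -val_eqE /= => /negbTE ->; rewrite mul0r.
rewrite big1 // => i _; case: eqP => [im|]; last by rewrite mul0r.
by have := ltn_ord i; rewrite im ltnS leqNgt mn.
Qed.

Lemma fps_monoV (b : rat) (m : nat) : (0 < m)%N ->
  (1 + fps_mono b m) * fps_geom b m = 1.
Proof.
move=> m0; rewrite mulrDl mul1r; apply: fpsP => n.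
rewrite fps_coefD fps_coef_monoM fps_coef1 /fps_geom.
case: (leqP m n) => mn.
  rewrite (dvdn_subl _ (dvdnn m)) //; have -> : (n == 0)%N = false by case: n mn m0 => //; case: m.
  case: ifP => [/dvdnP[q E]|]; last by rewrite mulr0 addr0.
  rewrite E in mn *; case: q E mn => [|q] _ mn; first by rewrite mul0n leqn0 in mn; rewrite (eqP mn) in m0.
  by rewrite mulSn addKn -mulSn !mulnK // exprS mulNr addNr.
rewrite addr0; case: n mn => [|n] mn; first by rewrite dvdn0 div0n.
by rewrite gtnNdvd.
Qed.

(** The logarithmic derivative of [1 + b z^m] has the coefficients [- m (-b)^k] at [n = k m] with
    [k > 0]. For [p] dividing [k] the claim is [zloc_fermat_pow] for [-b]; otherwise [k] is a
    unit. *)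
Lemma gauss_geom (p m : nat) (b : rat) : prime p -> b \in zloc p -> (0 < m)%N ->
  gauss p (theta (fps_mono b m) * fps_geom b m).
Proof.
move=> pp bp m0; have p0 := prime_gt0 pp.
have -> : theta (fps_mono b m) = fps_mono (m%:R * b) m.
  by apply: fpsP => n; rewrite /theta /fps_mono; case: eqP => [->|_]; rewrite ?mulr0.
set c := _ * _.
have cE n : c n = if (0 < n)%N && (m %| n)%N then - m%:R * (- b) ^+ (n %/ m) else 0.
  rewrite /c fps_coef_monoM; case: (leqP m n) => mn.
    rewrite (leq_trans m0 mn) /fps_geom (dvdn_subl _ (dvdnn m)) //; case: ifP => [/dvdnP[q E]|]; last by rewrite mulr0.
    rewrite E in mn *; case: q E mn => [|q] _ mn; first by rewrite mul0n leqn0 in mn; rewrite (eqP mn) in m0.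
    by rewrite mulSn addKn -mulSn !mulnK // exprS; ring.
  by case: n mn => [|n] mn //; rewrite gtnNdvd.
move=> n; rewrite cE /fps_subst cE.
have [->|n0] := posnP n; first by rewrite /= div0n if_same subrr rpred0.
have nb : - b \in zloc p by rewrite rpredN.
have [/dvdnP[k E] | mn] := boolP (m %| n)%N; last first.
  rewrite !andbF sub0r rpredN; case: ifP => [/dvdnP[q E]|]; last by rewrite rpred0.
  rewrite E mulnK //; case: ifP => [/andP[_ mq]|]; last by rewrite rpred0.
  by rewrite E dvdn_mulr in mn.
rewrite E in n0 *; have k0 : (0 < k)%N by case: k n0 {E}.
rewrite /= mulnK // natrM.
have mR : (m%:R : rat) != 0 by rewrite pnatr_eq0 -lt0n.
have [pk|pk] := boolP (p %| k)%N.
  have pow := zloc_fermat_pow pp nb pk k0.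
  case/dvdnP: pk => r Er; have kE : (k * m %/ p = r * m)%N by rewrite Er mulnAC mulnK ?prime_gt0.
  have r0 : (0 < r)%N by case: r Er k0 {kE} => // ->.
  have pkm : (p %| k * m)%N by rewrite Er dvdn_mulr // dvdn_mull.
  rewrite pkm kE muln_gt0 r0 m0 dvdn_mull //= mulnK //.
  rewrite {2}Er mulnK // in pow.
  by rewrite -mulrBr mulNr rpredN [_ * m%:R]mulrC zid_mul2l.
(* If [m] divided [n %/ p], then [p] would divide [k]. *)
rewrite [X in - m%:R * _ - X](_ : _ = 0); last first.
  case: ifP => // /dvdnP[q Eq]; case: ifP => // /andP[_].
  rewrite Eq mulnK // => /dvdnP[r Er].
  by move/eqP: Eq; rewrite Er mulnAC eqn_pmul2r // => /eqP Ek; rewrite Ek dvdn_mull in pk.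
rewrite subr0 mulNr rpredN [k%:R * _]mulrC zid_mul2l // zidE rpredM ?rpredX //.
by rewrite zlocV_nat // prime_coprime.
Qed.

(* Peel off the factors [1 + b z^m] of [f] one after the other. *)
Lemma gauss_theta (p : nat) (f c : fps) : prime p -> f 0%N = 1 ->
  (forall n, f n \in zloc p) -> c * f = theta f -> gauss p c.
Proof.
move=> pp f0 fp cf n.
(* Only coefficient [n] is at stake: [d] counts the factors still to be removed, and at [m = n.+1]
   the series is 1 up to order [n]. *)
suff H d m : (d + m)%N = n.+1 -> (0 < m)%N -> forall f c : fps, f 0%N = 1 ->
    (forall n, f n \in zloc p) -> c * f = theta f ->
    (forall i, (0 < i < m)%N -> f i = 0) -> c n - fps_subst p c n \in zid p n%:R.
  by apply: (H n 1%N) cf _; rewrite ?addn1 // => -[|[|i]].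
elim: d m => [|d IH] m dm m0 {f0 fp cf} f {}c f0 fp cf fm.
  rewrite add0n in dm; have c0 i : (i <= n)%N -> c i = 0.
    move=> le; rewrite (theta_coefS _ f0 cf) big1 ?subr0.
      by case: i le => [|i] le; rewrite ?mul0r // fm ?mulr0 //= dm.
    move=> j _; rewrite fm ?mulr0 //; have := ltn_ord j; lia.
  rewrite c0 // /fps_subst; case: ifP => _; last by rewrite subrr rpred0.
  by rewrite c0 ?subrr ?rpred0 // leq_div.
pose b := f m; pose G := fps_geom b m; pose M := fps_mono b m.
pose c1 := theta M * G; pose f1 := f * G.
have MG : (1 + M) * G = 1 by apply: fps_monoV.
have bp : b \in zloc p by apply: fp.
have thG : theta G = - (theta M * G * G).
  have := congr1 theta MG; rewrite thetaM thetaD theta1 add0r => E.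
  have {}E : (1 + M) * theta G = - (theta M * G).
    by apply/eqP; rewrite -addr_eq0 addrC E.
  by rewrite -[LHS]mul1r -MG mulrAC E mulNr.
(* Dividing [f] by [1 + b z^m] subtracts [c1] from its logarithmic derivative. *)
have c1f : (c - c1) * f1 = theta f1.
  by rewrite /f1 thetaM thG -cf /c1; ring.
have f1E : f1 = f - M * f1.
  have : (1 + M) * f1 = f by rewrite /f1 mulrCA MG mulr1.
  by rewrite mulrDl mul1r => <-; rewrite addrK.
have f1n i : f1 i = f i - (if (m <= i)%N then b * f1 (i - m)%N else 0).
  by rewrite {1}f1E fps_coefB fps_coef_monoM.
have f10 : f1 0%N = 1 by rewrite f1n leqNgt m0 subr0.
have -> : c = (c - c1) + c1 by rewrite subrK.
have -> : ((c - c1 + c1) n - fps_subst p (c - c1 + c1) n) =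
   ((c - c1) n - fps_subst p (c - c1) n) + (c1 n - fps_subst p c1 n).
  by rewrite /fps_subst; case: ifP => _; rewrite !fps_coefD; ring.
rewrite rpredD //; last exact: gauss_geom.
apply: (IH m.+1) c1f _ => //; first by rewrite addnS -addSn.
  move=> i; apply: rpred_sum => j _; rewrite rpredM //.
  by rewrite /G /fps_geom; case: ifP => _; rewrite ?rpred0 ?rpredX ?rpredN.
move=> i /andP[i0 im]; rewrite f1n; move: im; rewrite ltnS leq_eqVlt => /orP[/eqP ->|im].
  by rewrite leqnn subnn f10 mulr1 subrr.
by rewrite leqNgt im /= subr0 fm // i0.
Qed.

(** Strong induction: the truncation [f'] of [f] after order [n] is integral, so its logarithmic
    derivative [c'] satisfies the Gauss congruences. As [c] and [c'] agree up to [n] and differ by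
    [(n+1) f(n+1)] at [n+1], the congruences at [n+1] make [f(n+1)] integral. *)
Lemma gauss_integral (p : nat) (f c : fps) : prime p -> f 0%N = 1 ->
  c * f = theta f -> gauss p c -> forall n, f n \in zloc p.
Proof.
move=> pp f0 cf gc; elim/ltn_ind => -[|n] IH; first by rewrite f0 rpred1.
pose f' : fps := fun i => if (i < n.+1)%N then f i else 0.
pose c' : fps := theta f' * fps_inv f'.
have f'0 : f' 0%N = 1 by rewrite /f'.
have cf' : c' * f' = theta f'.
  rewrite /c' -mulrA [_ * f']mulrC (_ : f' * fps_inv f' = 1) ?mulr1 //.
  by apply: fpsP; apply: fps_mulV; rewrite f'0 oner_eq0.
have gc' : gauss p c'.
  apply: gauss_theta cf' => // i; rewrite /f'; case: ifP => li; last by rewrite rpred0.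
  exact: IH.
have cc i : (i <= n)%N -> c i = c' i.
  move=> le; apply: theta_coef_unique cf cf' _ => // j ji.
  by rewrite /f' ltnS (leq_trans ji le).
have E1 := theta_coefS n.+1 f0 cf; have E2 := theta_coefS n.+1 f'0 cf'.
have fE : n.+1%:R * f n.+1 = c n.+1 - c' n.+1.
  have f'n : f' n.+1 = 0 by rewrite /f' ltnn.
  rewrite E1 E2 f'n mulr0 sub0r !big_ord_recl.
  rewrite (theta_coef0 f0 cf) (theta_coef0 f'0 cf') !mul0r !add0r.
  have -> : \sum_(i < n) c (lift ord0 i) * f (n.+1 - lift ord0 i)%N =
            \sum_(i < n) c' (lift ord0 i) * f' (n.+1 - lift ord0 i)%N.
    apply: eq_bigr => i _; rewrite lift0 cc // /f' ltnS subSS leq_subr //.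
  by ring.
have : n.+1%:R * f n.+1 \in zid p n.+1%:R.
  have -> : n.+1%:R * f n.+1 = (c n.+1 - fps_subst p c n.+1) - (c' n.+1 - fps_subst p c' n.+1).
    rewrite fE /fps_subst; case: ifP => pn; last by ring.
    by rewrite (cc (n.+1 %/ p)%N); [ring | rewrite -ltnS ltn_Pdiv ?prime_gt1].
  by rewrite rpredB.
by rewrite zidE mulrAC mulfV ?mul1r // pnatr_eq0.
Qed.

(** The series [theta g] is the logarithmic derivative of [exp(g)], so integrality amounts to its
    Gauss congruences; [n g(n) - (n/p) g(n/p)] is [-(n/p)] times the expression
    [g(n/p) - p g(n)]. *)
Theorem dwork_exp (p : nat) (g : fps) : prime p -> g 0%N = 0 ->
  (forall n, fps_exp g n \in zloc p) <->
  (forall n, fps_subst p g n - p%:R * g n \in zid p p%:R).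
Proof.
move=> pp g0; have e0 := fps_exp0 g; have te := theta_exp g0.
have p0 : (p%:R : rat) != 0 by rewrite pnatr_eq0 -lt0n prime_gt0.
have E n : (0 < n)%N -> (theta g n - fps_subst p (theta g) n \in zid p n%:R) =
    (fps_subst p g n - p%:R * g n \in zid p p%:R).
  move=> n0; have n0R : (n%:R : rat) != 0 by rewrite pnatr_eq0 -lt0n.
  have -> : theta g n - fps_subst p (theta g) n = - (n%:R / p%:R * (fps_subst p g n - p%:R * g n)).
    rewrite /fps_subst /theta; case: ifP => [/dvdnP[q Eq]|_]; last by field.
    rewrite Eq mulnK ?prime_gt0 // natrM; field; exact: p0.
  rewrite rpredN -{2}(divfK p0 n%:R) zid_mul2l //.
  by rewrite mulf_neq0 // invr_eq0.
split=> h n.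
  have [->|n0] := posnP n.
    by rewrite /fps_subst dvdn0 div0n g0 mulr0 subrr rpred0.
  by rewrite -E //; apply: (gauss_theta (f := fps_exp g)).
apply: (gauss_integral (c := theta g)) => // i; have [->|n0] := posnP i.
  by rewrite /fps_subst dvdn0 div0n subrr rpred0.
by rewrite E.
Qed.

(** * Arithmetic of the multinomial coefficients *)

(** The quotient [(x + k)! / x!], a product of [k] consecutive integers. *)
Definition rising (x k : nat) : nat := \prod_(l < k) (x + l.+1)%N.

Lemma fact_rising x k : ((x + k)`! = x`! * rising x k)%N.
Proof.
elim: k => [|k IH]; first by rewrite addn0 /rising big_ord0 muln1.
by rewrite addnS factS IH /rising big_ord_recr /= addnS; ring.
Qed.

Lemma fact_dvdn_rising n x k : (n <= k)%N -> (n`! %| rising x k)%N.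
Proof.
move=> nk; apply: (@dvdn_trans k`!); first by rewrite -(subnKC nk) fact_rising dvdn_mulr.
apply/dvdnP; exists 'C(x + k, k); apply/eqP.
rewrite -(eqn_pmul2l (fact_gt0 x)) -fact_rising.
by have := bin_fact (leq_addl x k); rewrite addnK => <-; apply/eqP; ring.
Qed.

Lemma rising_split x k i : (i < k)%N ->
  rising x k = (rising x i * (x + i.+1) * rising (x + i.+1) (k - i.+1))%N.
Proof.
move=> ik; apply/eqP; rewrite -(eqn_pmul2l (fact_gt0 x)) -fact_rising.
rewrite !mulnA -fact_rising -{1}(subnKC ik) addnA fact_rising addnS factS.
by rewrite [(_.+1 * _)%N]mulnC.
Qed.

(** The part of [n!] prime to [p] once the multiples of [p] are left out; for [p] prime it is, up to
    sign, Morita's gamma function at [n + 1]. *)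
Definition pfact (p n : nat) : nat := \prod_(1 <= i < n.+1 | ~~ (p %| i)%N) i.

Lemma pfactS p n :
  pfact p n.+1 = ((if (p %| n.+1)%N then 1 else n.+1) * pfact p n)%N.
Proof.
rewrite /pfact big_mkcond big_nat_recr //= -big_mkcond /= mulnC.
by case: (p %| _)%N.
Qed.

Lemma pfact0 p : pfact p 0 = 1%N.
Proof. by rewrite /pfact big_geq. Qed.

Lemma fact_pfact p n : (0 < p)%N ->
  (n`! = p ^ (n %/ p) * (n %/ p)`! * pfact p n)%N.
Proof.
move=> p0; elim: n => [|n IH]; first by rewrite div0n pfact0.
rewrite factS IH pfactS divnS //; case: ifP => /= [/dvdnP[q E]|_]; last by rewrite add0n; ring.
rewrite add1n expnS factS.
have -> : (n.+1 = p * (n %/ p).+1)%N; last by ring.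
have := divnS n p0; rewrite E mulnK // dvdn_mull // add1n => <-.
exact: mulnC.
Qed.

Lemma coprime_pfact p n : prime p -> coprime p (pfact p n).
Proof.
move=> pp; elim: n => [|n IH]; first by rewrite pfact0 coprimen1.
rewrite pfactS coprimeMr IH andbT; case: ifP => [_|/negbT h]; first by rewrite coprimen1.
by rewrite prime_coprime.
Qed.

Lemma pfact_addl p q y : (p %| q)%N ->
  (pfact p (q + y) = pfact p q * pfact p y %[mod q])%N.
Proof.
move=> pq; elim: y => [|y IH]; first by rewrite addn0 pfact0 muln1.
rewrite addnS !pfactS -addnS dvdn_addr // mulnCA -modnMmr IH modnMmr.
by case: ifP => // _; rewrite -modnMml modnDl modnMml.
Qed.

Lemma pfact_add p q y n : (p %| q)%N ->
  (pfact p (y + n * q) = pfact p y * pfact p q ^ n %[mod q])%N.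
Proof.
move=> pq; elim: n => [|n IH]; first by rewrite mul0n addn0 muln1.
rewrite mulSn addnCA pfact_addl // -modnMmr IH modnMmr expnS.
by congr (_ %% _)%N; ring.
Qed.

Lemma zid_modn p (q a b : nat) : (0 < q)%N -> (a = b %[mod q])%N ->
  a%:R - b%:R \in zid p q%:R.
Proof.
move=> q0 ab; rewrite (divn_eq a q) (divn_eq b q) ab !natrD !natrM.
have -> : forall x y z w : rat, x * z + w - (y * z + w) = z * (x - y) by move=> *; ring.
by rewrite zid_mulr // rpredB // zloc_nat.
Qed.

Definition pratio (p N x : nat) : rat := (pfact p (N * x))%:R / (pfact p x)%:R ^+ N.

Lemma pfact_neq0 p n : prime p -> (pfact p n)%:R != 0 :> rat.
Proof.
move=> pp; rewrite pnatr_eq0; apply: contraTneq (coprime_pfact n pp) => ->.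
by rewrite /coprime gcdn0 neq_ltn prime_gt1 ?orbT.
Qed.

Lemma zlocV_pfact p n : prime p -> (pfact p n)%:R^-1 \in zloc p.
Proof. by move=> pp; rewrite zlocV_nat // coprime_pfact. Qed.

Lemma zloc_pratio p N x : prime p -> pratio p N x \in zloc p.
Proof. by move=> pp; rewrite rpredM ?zloc_nat // -exprVn rpredX // zlocV_pfact. Qed.

Lemma zlocV_pratio p N x : prime p -> (pratio p N x)^-1 \in zloc p.
Proof. by move=> pp; rewrite invf_div rpredM ?rpredX ?zloc_nat // zlocV_pfact. Qed.

(** Modulo [q], the shift by [n q] multiplies numerator and denominator by the same factor
    [pfact p q ^ (n N)]. *)
Lemma pratio_add p N x n q : prime p -> (p %| q)%N -> (0 < q)%N ->
  pratio p N (x + n * q) - pratio p N x \in zid p q%:R.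
Proof.
move=> pp pq q0; rewrite /pratio; set P' := (pfact p (N * _))%:R.
set Q' := _%:R ^+ N; set P := (pfact p (N * _))%:R; set Q := _%:R ^+ N.
pose W : rat := ((pfact p q) ^ (n * N))%N%:R.
have PW : P' - P * W \in zid p q%:R.
  rewrite -natrM; apply: zid_modn => //.
  by rewrite mulnDr mulnA [(N * n)%N]mulnC pfact_add.
have QW : Q' - Q * W \in zid p q%:R.
  rewrite /Q /Q' -!natrX -natrM; apply: zid_modn => //.
  by rewrite -modnXm pfact_add // modnXm expnMn -expnM.
have Q0 : Q != 0 by rewrite expf_neq0 // pfact_neq0.
have Q'0 : Q' != 0 by rewrite expf_neq0 // pfact_neq0.
have -> : P' / Q' - P / Q = ((P' - P * W) * Q - (Q' - Q * W) * P) * (Q'^-1 * Q^-1).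
  by field; rewrite Q0.
apply: zidMr.
  by rewrite rpredB // zidMr // ?rpredX ?zloc_nat.
by rewrite /Q /Q' -!exprVn rpredM ?rpredX // zlocV_pfact.
Qed.

Lemma mulnDMr N b m p : (0 < p)%N -> ((N * (b + m * p)) %/ p = N * m + N * b %/ p)%N.
Proof. by move=> p0; rewrite mulnDr mulnA addnC divnMDl. Qed.

Lemma multinom_neq0 N m : multinom_coef N m != 0.
Proof.
by rewrite mulf_neq0 ?invr_eq0 ?expf_neq0 // pnatr_eq0 -lt0n fact_gt0.
Qed.

Lemma multinom0 N : multinom_coef N 0 = 1.
Proof. by rewrite /multinom_coef muln0 expr1n divr1. Qed.

(** The multiples of [p] in [(N (b + m p))!] and [(b + m p)!] are separated by [fact_pfact]. The
    carry [N b %/ p] counts the extra multiples in the numerator, and [pratio] is a unit. *)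
Lemma multinom_step p N b m : prime p -> (b < p)%N ->
  multinom_coef N (b + m * p) = multinom_coef N m *
    (p%:R ^+ (N * b %/ p) * (rising (N * m) (N * b %/ p))%:R) * pratio p N (b + m * p).
Proof.
move=> pp bp; have p0 := prime_gt0 pp.
rewrite /multinom_coef /pratio (fact_pfact (N * (b + m * p)) p0) mulnDMr //.
have mE : ((b + m * p) %/ p = m)%N by rewrite addnC divnMDl // divn_small // addn0.
rewrite (fact_pfact (b + m * p) p0) mE fact_rising.
rewrite expnD !natrM !exprMn !natrX -!exprM [(m * N)%N]mulnC.
have pR : (p%:R : rat) != 0 by rewrite pnatr_eq0 -lt0n.
have m0 : (m`!%:R : rat) != 0 by rewrite pnatr_eq0 -lt0n fact_gt0.
field.
by rewrite !expf_neq0 ?pfact_neq0.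
Qed.

Lemma multinom_dvd_step p N b m : prime p -> (b < p)%N ->
  multinom_coef N (b + m * p) \in zid p (multinom_coef N m).
Proof.
move=> pp bp; rewrite multinom_step // -mulrA zid_mulr //.
by rewrite rpredM ?zloc_pratio // rpredM ?rpredX ?zloc_nat.
Qed.

Lemma multinom_dvd p N s u n : prime p -> (u < p ^ s)%N ->
  multinom_coef N (u + n * p ^ s) \in zid p (multinom_coef N n).
Proof.
move=> pp; elim: s u => [|s IH] u us.
  by rewrite expn0 ltnS leqn0 in us; rewrite (eqP us) muln1 zid_self.
have p0 := prime_gt0 pp.
apply: (@zid_trans _ (multinom_coef N (u %/ p + n * p ^ s))); first exact: multinom_neq0.
  have -> : (u + n * p ^ s.+1 = u %% p + (u %/ p + n * p ^ s) * p)%N.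
    by rewrite {1}(divn_eq u p) expnSr; ring.
  by apply: multinom_dvd_step; rewrite ?ltn_pmod.
by apply: IH; rewrite ltn_divLR // -expnSr.
Qed.

Lemma rising_modn x y k q : (x = y %[mod q])%N -> (rising x k = rising y k %[mod q])%N.
Proof.
move=> xy; rewrite /rising; elim: k => [|k IH]; first by rewrite !big_ord0.
rewrite !big_ord_recr /= -modnMm IH modnMm -modnMmr -modnDml xy modnDml modnMmr.
by [].
Qed.

(* Hypothesis (iii) of Dwork's theorem on formal congruences. *)
Lemma multinom_dwork p N s x n : prime p -> (x < p ^ s.+1)%N ->
  multinom_coef N (x + n * p ^ s.+1) -
    multinom_coef N (x %/ p + n * p ^ s) * (multinom_coef N x / multinom_coef N (x %/ p))
    \in zid p (p%:R ^+ s.+1 * multinom_coef N n).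
Proof.
move=> pp xs; have p0 := prime_gt0 pp.
set v := (x %% p)%N; set u := (x %/ p)%N.
have xE : x = (v + u * p)%N by rewrite addnC -divn_eq.
have vp : (v < p)%N by rewrite ltn_pmod.
have us : (u < p ^ s)%N by rewrite ltn_divLR // -expnSr.
set u' := (u + n * p ^ s)%N.
have xE' : (x + n * p ^ s.+1 = v + u' * p)%N by rewrite /u' mulnDl -mulnA -expnSr addnA -xE.
set k := (N * v %/ p)%N.
have -> : multinom_coef N x / multinom_coef N u = p%:R ^+ k * (rising (N * u) k)%:R * pratio p N x.
  by rewrite {1}xE multinom_step // -xE -[X in X / _]mulrA mulrAC mulfV ?mul1r ?multinom_neq0.
have -> : multinom_coef N (x + n * p ^ s.+1) =
    multinom_coef N u' * (p%:R ^+ k * (rising (N * u') k)%:R) * pratio p N (x + n * p ^ s.+1).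
  by rewrite xE' multinom_step.
set B := multinom_coef N u'; set U' := pratio _ _ _; set U := pratio _ _ _.
set r' := rising _ _; set r := rising _ _.
have Bn : B \in zid p (multinom_coef N n) by apply: multinom_dvd.
(* The change is split into that of the unit part, controlled by [pratio_add], and that of the
   rising product. *)
have -> : B * (p%:R ^+ k * r'%:R) * U' - B * (p%:R ^+ k * r%:R * U) =
   (p%:R ^+ k * r'%:R * (U' - U) + (p%:R ^+ k * (r'%:R - r%:R)) * U) * B by ring.
have qS : p%:R ^+ s.+1 = (p ^ s.+1)%:R :> rat by rewrite natrX.
apply: zidM => //; rewrite rpredD //.
  apply: zidMl; first by rewrite rpredM ?rpredX ?zloc_nat.
  by rewrite qS; apply: pratio_add; rewrite // ?dvdn_exp // expn_gt0 p0.
apply: zidMr; last exact: zloc_pratio.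
(* The arguments of the rising products agree only modulo [p^s]; the missing power comes from [p^k]
   if [k > 0], and for [k = 0] both products are empty. *)
have [k0|k0] := posnP k.
  by rewrite /r /r' k0 /rising !big_ord0 subrr mulr0 rpred0.
apply: (@zid_exp p (k + s)) => //; first by rewrite -{1}(add0n s) -addSn leq_add2r.
rewrite exprD; apply: zidM; first exact: zid_self.
rewrite -natrX; apply: zid_modn; first by rewrite expn_gt0 p0.
by apply: rising_modn; rewrite /u' mulnDr mulnA addnC modnMDl.
Qed.

(** The quotient counts the partitions of [N m] points into [N] blocks of size [m]. The induction
    uses that the binomial coefficient of [(N+1) m] over [m] is [N+1] times that of [(N+1) m - 1]
    over [m - 1]. *)
Lemma fact_dvd_multinom p N m : (0 < m)%N -> multinom_coef N m \in zid p N`!%:R.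
Proof.
move=> m0; suff /dvdnP[q E] : (N`! * m`! ^ N %| (N * m)`!)%N.
  rewrite zidE /multinom_coef E !natrM natrX.
  have f0 n : (n`!%:R : rat) != 0 by rewrite pnatr_eq0 -lt0n fact_gt0.
  have -> : q%:R * (N`!%:R * m`!%:R ^+ N) / m`!%:R ^+ N / N`!%:R = q%:R :> rat.
    by field; rewrite f0 expf_neq0.
  exact: zloc_nat.
elim: N => [|N IH]; first by rewrite mul0n.
have := bin_fact (leq_addr (N * m) m); rewrite addKn -mulSn => <-.
have : (m * 'C(N.+1 * m, m) = m * (N.+1 * 'C((N.+1 * m).-1, m.-1)))%N.
  have := mul_bin_diag (N.+1 * m) m.-1; rewrite prednK // => <-; ring.
move/eqP; rewrite eqn_pmul2l // => /eqP ->.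
rewrite factS expnS; case/dvdnP: IH => q ->; apply/dvdnP; exists (q * 'C((N.+1 * m).-1, m.-1))%N.
ring.
Qed.

(** * Dwork's formal congruences *)

Lemma big_ord_mul (V : zmodType) (n a b : nat) (Y : nat -> V) : n = (a * b)%N ->
  \sum_(l < n) Y l = \sum_(i < a) \sum_(j < b) Y (i * b + j)%N.
Proof.
move=> ->; elim: a => [|a IH]; first by rewrite mul0n !big_ord0.
by rewrite big_ord_recr /= -IH mulSnr big_split_ord.
Qed.

(** The guard sets the terms with [j > K] to 0, where the natural subtraction [K - j] would be
    truncated. *)
Definition dwork_term (p : nat) (A : nat -> rat) (a K j : nat) : rat :=
  if (j <= K)%N then A (a + j * p)%N * A (K - j)%N - A j * A (a + (K - j) * p)%N
  else 0.

Definition dwork_sum (p : nat) (A : nat -> rat) (a K s m : nat) : rat :=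
  \sum_(j < p ^ s) dwork_term p A a K (m * p ^ s + j).

Lemma dwork_sumS p A a K s m :
  dwork_sum p A a K s.+1 m = \sum_(i < p) dwork_sum p A a K s (m * p + i).
Proof.
rewrite /dwork_sum (big_ord_mul (fun l => dwork_term p A a K (m * p ^ s.+1 + l)) (expnS p s)).
apply: eq_bigr => i _; apply: eq_bigr => j _.
by rewrite mulnDl addnA -mulnA -expnS.
Qed.

Lemma dwork_sum_high p A a K s m : (K < m * p ^ s)%N -> dwork_sum p A a K s m = 0.
Proof.
move=> Km; rewrite /dwork_sum big1 // => j _; rewrite /dwork_term.
by rewrite leqNgt (leq_trans Km) // leq_addr.
Qed.

(* The terms are antisymmetric under [j |-> K - j]. *)
Lemma dwork_sum_total p A a K M : (K < M)%N -> \sum_(j < M) dwork_term p A a K j = 0.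
Proof.
move=> KM; rewrite -(subnKC KM) big_split_ord /= [X in _ + X]big1 ?addr0; last first.
  by move=> j _; rewrite /dwork_term leqNgt addSn ltnS leq_addr.
have -> : \sum_(j < K.+1) dwork_term p A a K j =
   \sum_(j < K.+1) A (a + j * p)%N * A (K - j)%N -
   \sum_(j < K.+1) A j * A (a + (K - j) * p)%N.
  by rewrite -sumrB; apply: eq_bigr => j _; rewrite /dwork_term leq_ord.
rewrite [X in _ - X](reindex_inj rev_ord_inj) /=.
apply/eqP; rewrite subr_eq0; apply/eqP; apply: eq_bigr => j _.
by rewrite subSS subKn ?leq_ord // mulrC.
Qed.

Section DworkCongruence.

Variables (p : nat) (A : nat -> rat) (a : nat).
Hypothesis pp : prime p.
Hypothesis ap : (a < p)%N.
Hypothesis A0 : A 0%N = 1.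
Hypothesis An0 : forall n, A n != 0.
Hypothesis Ap : forall n, A n \in zloc p.
Hypothesis Acong : forall s x n, (x < p ^ s.+1)%N ->
  A (x + n * p ^ s.+1)%N - A (x %/ p + n * p ^ s)%N * (A x / A (x %/ p)%N)
    \in zid p (p%:R ^+ s.+1 * A n).

Let p0 : (0 < p)%N := prime_gt0 pp.

Let pR : (p%:R : rat) != 0. Proof. by rewrite pnatr_eq0 -lt0n. Qed.

Let divpE j : ((a + j * p) %/ p = j)%N.
Proof. by rewrite addnC divnMDl // divn_small // addn0. Qed.

(** Dwork's interpolation in [t]: at [t = 0] it is [Acong] term by term, and at [t = s] it compares
    block [m] with [A m] times block 0 for a smaller [K]. Each step groups blocks by [p] and changes
    the ratio in front by [Acong] again. *)
Lemma dwork_beta (s t K m : nat) :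
  (forall t K j, (t < s)%N -> dwork_sum p A a K t j \in zid p (p%:R ^+ t.+1 * A j)) ->
  (t <= s)%N ->
  dwork_sum p A a (K + m * p ^ s) s m -
    \sum_(j < p ^ (s - t)) A (j + m * p ^ (s - t))%N / A j * dwork_sum p A a K t j
    \in zid p (p%:R ^+ s.+1 * A m).
Proof.
move=> alpha; elim: t => [|t IH] ts.
  rewrite subn0 /dwork_sum -sumrB; apply: rpred_sum => j _.
  rewrite expn0 big_ord1 muln1 addn0 /dwork_term addnC leq_add2r.
  case: leqP => jK; last by rewrite mulr0 subrr rpred0.
  rewrite subnDr.
  have -> : (a + (j + m * p ^ s) * p = (a + j * p) + m * p ^ s.+1)%N.
    by rewrite expnSr; ring.
  have := @Acong s (a + j * p) m; rewrite divpE => Ac.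
  set A1 := A (_ + _ * _ ^ _)%N; set A2 := A (j + _)%N.
  have -> : A1 * A (K - j)%N - A2 * A (a + (K - j) * p)%N -
     A2 / A j * (A (a + j * p)%N * A (K - j)%N - A j * A (a + (K - j) * p)%N) =
     (A1 - A2 * (A (a + j * p)%N / A j)) * A (K - j)%N by field; apply: An0.
  apply: zidMr => //; apply: Ac; rewrite expnSr.
  have : (j.+1 * p <= p ^ s * p)%N by rewrite leq_mul2r ltn_ord orbT.
  by apply: leq_trans; rewrite mulSn ltn_add2r.
rewrite -(subrK (\sum_(j < p ^ (s - t)) A (j + m * p ^ (s - t))%N / A j * dwork_sum p A a K t j)
  (dwork_sum _ _ _ _ _ _)) -addrA rpredD //; first by apply: IH; apply: ltnW.
have -> : (s - t = (s - t.+1).+1)%N by rewrite subnSK.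
set r := (s - t.+1)%N; rewrite (big_ord_mul (fun l => A (l + m * p ^ r.+1)%N / A l * dwork_sum p A a K t l) (expnSr p r)) -sumrB; apply: rpred_sum => j _.
rewrite dwork_sumS mulr_sumr -sumrB; apply: rpred_sum => i _; rewrite -mulrBl.
have jp : ((j * p + i) %/ p = j)%N by rewrite divnMDl // divn_small // addn0.
have jr : (j * p + i < p ^ r.+1)%N by rewrite expnSr -ltn_divLR // jp.
have := Acong m jr; rewrite jp => Ac.
(* The change of ratio supplies the first factor of the modulus, the block of level [t < s] the
   second. *)
have -> : p%:R ^+ s.+1 * A m = (p%:R ^+ r.+1 * A m / A (j * p + i)%N) * (p%:R ^+ t.+1 * A (j * p + i)%N).
  have -> : (s.+1 = r.+1 + t.+1)%N by rewrite /r; lia.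
  by rewrite exprD; field; apply: An0.
apply: zidM; last exact: alpha.
have -> : A (j * p + i + m * p ^ r.+1)%N / A (j * p + i)%N - A (j + m * p ^ r)%N / A j =
  (A (j * p + i + m * p ^ r.+1)%N - A (j + m * p ^ r)%N * (A (j * p + i)%N / A j)) / A (j * p + i)%N.
  by field; rewrite !An0.
by apply: zidM => //; apply: zid_self.
Qed.

(** Induction on [s]. By [dwork_beta] at [t = s] everything reduces to block 0; as all blocks
    together sum to 0, block 0 is minus the sum of the others, which reduce to block 0 for smaller
    [K]. *)
Lemma dwork_congruence (K s m : nat) :
  dwork_sum p A a K s m \in zid p (p%:R ^+ s.+1 * A m).
Proof.
elim/ltn_ind: s K m => s IHs.
have alpha t K j : (t < s)%N -> dwork_sum p A a K t j \in zid p (p%:R ^+ t.+1 * A j).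
  by move=> ts; apply: IHs.
have beta K m : dwork_sum p A a (K + m * p ^ s) s m - A m * dwork_sum p A a K s 0
    \in zid p (p%:R ^+ s.+1 * A m).
  have := @dwork_beta s s K m alpha (leqnn s).
  by rewrite subnn expn0 big_ord1 add0n muln1 A0 divr1.
have S0 K : dwork_sum p A a K s 0 \in zid p (p%:R ^+ s.+1).
  elim/ltn_ind: K => K IHK.
  have : \sum_(m < K.+1) dwork_sum p A a K s m = 0.
    rewrite -(big_ord_mul (dwork_term p A a K) erefl); apply: dwork_sum_total.
    by rewrite -{1}(muln1 K.+1) leq_mul2l expn_gt0 p0 orbT.
  rewrite big_ord_recl => /eqP; rewrite addr_eq0 => /eqP ->.
  rewrite rpredN; apply: rpred_sum => i _; rewrite lift0.
  have [le | lt] := leqP (i.+1 * p ^ s) K; last by rewrite dwork_sum_high ?rpred0.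
  have := beta (K - i.+1 * p ^ s)%N i.+1; rewrite subnK // => h.
  rewrite -(subrK (A i.+1 * dwork_sum p A a (K - i.+1 * p ^ s) s 0) (dwork_sum _ _ _ _ _ _)).
  rewrite rpredD //.
    apply: zid_trans h _; first by rewrite mulf_neq0 // expf_neq0.
    exact: zid_mulr.
  apply: zidMl => //; apply: IHK; rewrite ltn_subrL muln_gt0 expn_gt0 p0 /=.
  by apply: leq_trans le; rewrite muln_gt0 expn_gt0 p0.
move=> K m; have [le | lt] := leqP (m * p ^ s) K; last by rewrite dwork_sum_high ?rpred0.
have := beta (K - m * p ^ s)%N m; rewrite subnK // => h.
rewrite -(subrK (A m * dwork_sum p A a (K - m * p ^ s) s 0) (dwork_sum _ _ _ _ _ _)).
by rewrite rpredD // mulrC; apply: zidM => //; apply: zid_self.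
Qed.

End DworkCongruence.

(** * Harmonic numbers and Wolstenholme's theorem *)

Definition psum (p n : nat) : rat := \sum_(1 <= i < n.+1 | ~~ (p %| i)%N) (i%:R)^-1.

Lemma psumS p n :
  psum p n.+1 = psum p n + (if (p %| n.+1)%N then 0 else (n.+1%:R)^-1).
Proof.
rewrite /psum big_mkcond big_nat_recr //= -big_mkcond /=.
by case: (p %| _)%N.
Qed.

Lemma harmonicS n : harmonic n.+1 = harmonic n + (n.+1%:R)^-1.
Proof. by rewrite /harmonic big_nat_recr. Qed.

Lemma harmonic0 : harmonic 0 = 0.
Proof. by rewrite /harmonic big_geq. Qed.

Lemma harmonicD x k : harmonic (x + k) = harmonic x + \sum_(i < k) ((x + i.+1)%:R)^-1.
Proof.
elim: k => [|k IH]; first by rewrite addn0 big_ord0 addr0.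
by rewrite addnS harmonicS IH big_ord_recr /= addnS addrA.
Qed.

Lemma harmonicE n : harmonic n = \sum_(i < n) (i.+1%:R)^-1.
Proof. by rewrite -[n]add0n harmonicD harmonic0 add0r. Qed.

(** The inverses of the multiples of [p] up to [n] add up to [H_{n/p} / p]. *)
Lemma harmonic_psum p n : (0 < p)%N ->
  p%:R * harmonic n = harmonic (n %/ p) + p%:R * psum p n.
Proof.
move=> p0; have pR : (p%:R : rat) != 0 by rewrite pnatr_eq0 -lt0n.
elim: n => [|n IH]; first by rewrite div0n harmonic0 mulr0 /psum big_geq // mulr0 addr0.
rewrite harmonicS mulrDr IH psumS divnS //; case: ifP => [pn|_]; last by rewrite add0n mulrDr addrA.
have E : n.+1%:R = p%:R * (n %/ p).+1%:R :> rat.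
  by rewrite -natrM -[(n %/ p).+1]add1n; have := divnS n p0; rewrite pn => <-; rewrite mulnC divnK.
rewrite add1n harmonicS addr0 E invfM mulrA mulfV // mul1r; ring.
Qed.

Lemma zloc_psum p n : prime p -> psum p n \in zloc p.
Proof.
by move=> pp; apply: rpred_sum => i pi; rewrite zlocV_nat // prime_coprime.
Qed.

Lemma coprime_lt p i : prime p -> (0 < i < p)%N -> coprime p i.
Proof.
move=> pp /andP[i0 ip]; rewrite prime_coprime //; apply: contraTN ip => pi.
by rewrite -leqNgt dvdn_leq.
Qed.

Lemma coprime_add_mul p k i : prime p -> (0 < i < p)%N -> coprime p (k * p + i).
Proof.
move=> pp ip; rewrite prime_coprime // dvdn_addr ?dvdn_mull // -prime_coprime //.
exact: coprime_lt.
Qed.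

Lemma psum_block p m : prime p ->
  psum p (m.+1 * p) = psum p (m * p) + \sum_(i < p.-1) ((m * p + i.+1)%:R)^-1.
Proof.
move=> pp; have p0 := prime_gt0 pp.
have H k : (k < p)%N ->
    psum p (m * p + k) = psum p (m * p) + \sum_(i < k) ((m * p + i.+1)%:R)^-1.
  elim: k => [|k IH] kp; first by rewrite addn0 big_ord0 addr0.
  rewrite addnS psumS IH ?(ltnW kp) // big_ord_recr /= addrA -addnS.
  by have := coprime_add_mul m pp (kp : (0 < k.+1 < p)%N); rewrite prime_coprime // => /negbTE ->.
have E : (m.+1 * p = (m * p + p.-1).+1)%N by rewrite -addnS prednK // mulSnr.
by rewrite -H ?prednK // E psumS -E dvdn_mull // addr0.
Qed.

Lemma sum_rev_ord (n : nat) (f : nat -> rat) :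
  \sum_(i < n) f i.+1 = \sum_(i < n) f (n.+1 - i.+1)%N.
Proof.
rewrite (reindex_inj rev_ord_inj) /=; apply: eq_bigr => i _.
by rewrite subSS subnSK.
Qed.

Lemma zid_half p x y : prime p -> (2 < p)%N -> 2%:R * x \in zid p y -> x \in zid p y.
Proof.
move=> pp p2; rewrite mulrC; apply: zid_mulrI => //.
by rewrite zlocV_nat // coprime_lt.
Qed.

(** The terms at [i] and [p - i] are paired: their denominators add up to [(2k + 1) p]. *)
Lemma block_sum_zid p k : prime p -> (2 < p)%N ->
  \sum_(i < p.-1) ((k * p + i.+1)%:R)^-1 \in zid p p%:R.
Proof.
move=> pp p2; have p0 := prime_gt0 pp; apply: zid_half => //.
have := sum_rev_ord p.-1 (fun i => ((k * p + i)%:R)^-1); rewrite prednK // => E.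
rewrite mulr_natl mulr2n {2}E -big_split /=; apply: rpred_sum => i _.
have ip : (i.+1 < p)%N by rewrite -ltn_predRL ltn_ord.
have c1 := coprime_add_mul k pp (ip : (0 < i.+1 < p)%N).
have ip2 : (0 < p - i.+1 < p)%N by lia.
have c2 := coprime_add_mul k pp ip2.
have n1 : ((k * p + i.+1)%:R : rat) != 0 by rewrite pnatr_eq0 addnS.
have n2 : ((k * p + (p - i.+1))%:R : rat) != 0 by rewrite pnatr_eq0; lia.
have -> : ((k * p + i.+1)%:R)^-1 + ((k * p + (p - i.+1))%:R)^-1 =
  p%:R * ((k + k).+1%:R * ((k * p + i.+1)%:R)^-1 * ((k * p + (p - i.+1))%:R)^-1) :> rat.
  have sE : (k + k).+1%:R * p%:R = (k * p + i.+1)%:R + (k * p + (p - i.+1))%:R :> rat.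
    by rewrite -natrD -natrM addnACA (subnKC (ltnW ip)) -mulnDl -mulSnr.
  rewrite !mulrA [p%:R * _]mulrC sE.
  move: ((k * p + i.+1)%:R : rat) ((k * p + (p - i.+1))%:R : rat) n1 n2 {sE} => x y n1 n2.
  by field; rewrite ?n1 ?n2.
by rewrite zid_mulr // !rpredM ?zloc_nat ?zlocV_nat.
Qed.

Lemma psum_mul_zid p m : prime p -> (2 < p)%N -> psum p (m * p) \in zid p p%:R.
Proof.
move=> pp p2; elim: m => [|m IH]; first by rewrite mul0n /psum big_geq // rpred0.
by rewrite psum_block // rpredD // block_sum_zid.
Qed.

(** * Power sums of inverses and Wolstenholme's theorem *)

Definition invsum (p r : nat) : rat := \sum_(i < p.-1) (i.+1%:R)^-1 ^+ r.

Lemma invsum3_zid p : prime p -> (2 < p)%N -> invsum p 3 \in zid p p%:R.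
Proof.
move=> pp p2; have p0 := prime_gt0 pp; apply: zid_half => //.
have := sum_rev_ord p.-1 (fun i => (i%:R)^-1 ^+ 3); rewrite prednK // => E.
rewrite mulr_natl mulr2n /invsum {2}E -big_split /=; apply: rpred_sum => i _.
have ip : (i.+1 < p)%N by rewrite -ltn_predRL ltn_ord.
have c1 := coprime_lt pp (ip : (0 < i.+1 < p)%N).
have ip2 : (0 < p - i.+1 < p)%N by lia.
have c2 := coprime_lt pp ip2.
have n1 : (i.+1%:R : rat) != 0 by rewrite pnatr_eq0.
have n2 : ((p - i.+1)%:R : rat) != 0 by rewrite pnatr_eq0; lia.
have pE : p%:R = i.+1%:R + (p - i.+1)%:R :> rat by rewrite -natrD subnKC // ltnW.
have zx : (i.+1%:R)^-1 \in zloc p by apply: zlocV_nat.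
have zy : ((p - i.+1)%:R)^-1 \in zloc p by apply: zlocV_nat.
have zx1 := zloc_nat p i.+1; have zy1 := zloc_nat p (p - i.+1).
rewrite zidE -zidE pE; move: (i.+1%:R) ((p - i.+1)%:R) n1 n2 zx zy zx1 zy1 pE => x y n1 n2 zx zy zx1 zy1 pE.
have -> : x^-1 ^+ 3 + y^-1 ^+ 3 = (x + y) * ((x ^+ 2 - x * y + y ^+ 2) * x^-1 ^+ 3 * y^-1 ^+ 3).
  by field; rewrite ?n1 ?n2.
by rewrite zid_mulr // !rpredM ?rpredX // rpredD ?rpredB ?rpredM ?rpredX.
Qed.

(** Let [T] be the sum over the first half. The symmetry [i -> p - i] gives [S = 2 T] modulo [p],
    and splitting into even and odd [i] gives [S = T / 2]. Hence [3 S = 0], and 3 is invertible for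
    [p > 3]. *)
Lemma invsum2_zid p : prime p -> (4 < p)%N -> invsum p 2 \in zid p p%:R.
Proof.
move=> pp p4; have p0 := prime_gt0 pp.
pose f (i : nat) : rat := (i%:R)^-1 ^+ 2; pose q := p./2.
have pq : p = (q + q).+1.
  have [p2|] := even_prime pp; first by rewrite p2 in p4.
  by move=> po; rewrite -{1}(odd_double_half p) po add1n -addnn.
have fsym i : (0 < i < p)%N -> f (p - i)%N - f i \in zid p p%:R.
  move=> ip; have c1 := coprime_lt pp ip; have ip2 : (0 < p - i < p)%N by lia.
  have c2 := coprime_lt pp ip2.
  have n1 : (i%:R : rat) != 0 by rewrite pnatr_eq0; lia.
  have n2 : ((p - i)%:R : rat) != 0 by rewrite pnatr_eq0; lia.
  have zx : (i%:R)^-1 \in zloc p by apply: zlocV_nat.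
  have zy : ((p - i)%:R)^-1 \in zloc p by apply: zlocV_nat.
  have zx1 := zloc_nat p i; have zy1 := zloc_nat p (p - i).
  have pE : p%:R = i%:R + (p - i)%:R :> rat by rewrite -natrD subnKC // ltnW; lia.
  have -> : f (p - i)%N - f i = p%:R * ((i%:R - (p - i)%:R) * (i%:R)^-1 ^+ 2 * ((p - i)%:R)^-1 ^+ 2).
    rewrite /f pE; move: (i%:R) ((p - i)%:R) n1 n2 => x y n1 n2.
    by field; rewrite ?n1 ?n2.
  by rewrite zid_mulr // !rpredM ?rpredX // rpredB.
have SE : invsum p 2 = \sum_(i < q + q) f i.+1 by rewrite /invsum pq.
pose T := \sum_(i < q) f i.+1.
have ST : invsum p 2 - 2%:R * T \in zid p p%:R.
  rewrite SE big_split_ord /= [X in _ + X - _](reindex_inj rev_ord_inj) /=.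
  rewrite mulr_natl mulr2n -/T opprD addrACA subrr add0r -sumrB.
  apply: rpred_sum => i _; have iq := ltn_ord i.
  have -> : (q + (q - i.+1)).+1 = (p - i.+1)%N by lia.
  by apply: fsym; lia.
have f2 i : f (i * 2)%N = 4%:R^-1 * f i.
  by rewrite /f natrM invfM exprMn mulrC; congr (_ * _); rewrite -exprVn -natrX.
(* The even indices [2 i] contribute [T / 4], and the odd ones are the [p - 2 i]. *)
have ST2 : invsum p 2 - 2%:R * (4%:R^-1 * T) \in zid p p%:R.
  rewrite SE (big_ord_mul (fun i => f i.+1) (n := q + q) (a := q) (b := 2)); last by lia.
  have -> : \sum_(i < q) \sum_(j < 2) f (i * 2 + j).+1 =
     \sum_(i < q) f (i * 2).+1 + \sum_(i < q) f (i.+1 * 2)%N.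
    rewrite -big_split /=; apply: eq_bigr => i _.
    by rewrite !big_ord_recl big_ord0 /= addn0 addr0 mulSnr addn1 addn2.
  have -> : \sum_(i < q) f (i.+1 * 2)%N = 4%:R^-1 * T.
    by rewrite mulr_sumr; apply: eq_bigr => i _; rewrite f2.
  rewrite mulr_natl mulr2n opprD addrACA subrr addr0.
  have <- : \sum_(i < q) f (i.+1 * 2)%N = 4%:R^-1 * T.
    by rewrite mulr_sumr; apply: eq_bigr => i _; rewrite f2.
  rewrite [X in X - _](reindex_inj rev_ord_inj) /= -sumrB.
  apply: rpred_sum => i _; have iq := ltn_ord i.
  have -> : ((q - i.+1) * 2).+1 = (p - i.+1 * 2)%N by lia.
  by apply: fsym; lia.
have : 3%:R * invsum p 2 \in zid p p%:R.
  have -> : 3%:R * invsum p 2 = 4%:R * (invsum p 2 - 2%:R * (4%:R^-1 * T)) - (invsum p 2 - 2%:R * T).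
    by field.
  by rewrite rpredB // zidMl // zloc_nat.
rewrite mulrC; apply: zid_mulrI => //.
by apply: zlocV_nat; apply: coprime_lt => //; lia.
Qed.

(** The terms [1 / i] and [1 / (p - i)] are added, the latter expanded in powers of [p] up to [p^2];
    the term [p^2 / i^3] sums to 0 modulo [p^3] by [invsum3_zid]. *)
Lemma harmonic_invsum2 p : prime p -> (2 < p)%N ->
  2%:R * harmonic p.-1 + p%:R * invsum p 2 \in zid p (p%:R ^+ 3).
Proof.
move=> pp p2; have p0 := prime_gt0 pp.
have := sum_rev_ord p.-1 (fun i => (i%:R)^-1); rewrite prednK // -harmonicE => E.
have : 2%:R * harmonic p.-1 + p%:R * invsum p 2 + p%:R ^+ 2 * invsum p 3 \in zid p (p%:R ^+ 3).
  rewrite mulr_natl mulr2n {2}E harmonicE /invsum !mulr_sumr -!big_split /=.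
  apply: rpred_sum => i _.
  have ip : (i.+1 < p)%N by rewrite -ltn_predRL ltn_ord.
  have c1 := coprime_lt pp (ip : (0 < i.+1 < p)%N).
  have ip2 : (0 < p - i.+1 < p)%N by lia.
  have c2 := coprime_lt pp ip2.
  have n1 : (i.+1%:R : rat) != 0 by rewrite pnatr_eq0.
  have n2 : ((p - i.+1)%:R : rat) != 0 by rewrite pnatr_eq0; lia.
  have pE : p%:R = i.+1%:R + (p - i.+1)%:R :> rat by rewrite -natrD subnKC // ltnW.
  have zx : (i.+1%:R)^-1 \in zloc p by apply: zlocV_nat.
  have zy : ((p - i.+1)%:R)^-1 \in zloc p by apply: zlocV_nat.
  rewrite pE; move: (i.+1%:R) ((p - i.+1)%:R) n1 n2 zx zy {pE} => x y n1 n2 zx zy.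
  have -> : x^-1 + y^-1 + (x + y) * x^-1 ^+ 2 + (x + y) ^+ 2 * x^-1 ^+ 3 = (x + y) ^+ 3 * (x^-1 ^+ 3 * y^-1).
    by field; rewrite ?n1 ?n2.
  by rewrite zid_mulr // rpredM ?rpredX.
move=> h; rewrite -(addrK (p%:R ^+ 2 * invsum p 3) (_ + _)) rpredB // [p%:R ^+ 3]exprSr.
by apply: zidM; [apply: zid_self | apply: invsum3_zid].
Qed.

Lemma wolstenholme p : prime p -> (4 < p)%N -> harmonic p.-1 \in zid p (p%:R ^+ 2).
Proof.
move=> pp p4; have p2 : (2 < p)%N by lia.
apply: zid_half => //; rewrite -(addrK (p%:R * invsum p 2) (_ * _)) rpredB //.
  by apply: zid_exp (harmonic_invsum2 pp p2) => //; apply: prime_gt0.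
by rewrite expr2; apply: zidM; [apply: zid_self | apply: invsum2_zid].
Qed.

(** Expanding [1 / (k p + i)] to second order and replacing [- p * invsum p 2] by [2 H_{p-1}], block
    [k] becomes [(2k + 1) H_{p-1}]; the odd numbers below [2m] add up to [m^2]. *)
Lemma psum_mul p m : prime p -> (4 < p)%N ->
  psum p (m * p) - m%:R ^+ 2 * harmonic p.-1 \in zid p (p%:R ^+ 3).
Proof.
move=> pp p4; have p2 : (2 < p)%N by lia.
have block k : \sum_(i < p.-1) ((k * p + i.+1)%:R)^-1 - (2%:R * k%:R + 1) * harmonic p.-1
    \in zid p (p%:R ^+ 3).
  have : \sum_(i < p.-1) ((k * p + i.+1)%:R)^-1 -
     (harmonic p.-1 - k%:R * p%:R * invsum p 2 + k%:R ^+ 2 * p%:R ^+ 2 * invsum p 3)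
     \in zid p (p%:R ^+ 3).
    rewrite harmonicE /invsum !mulr_sumr -sumrB -big_split -sumrB /=.
    apply: rpred_sum => i _.
    have ip : (i.+1 < p)%N by rewrite -ltn_predRL ltn_ord.
    have c1 := coprime_lt pp (ip : (0 < i.+1 < p)%N).
    have c2 := coprime_add_mul k pp (ip : (0 < i.+1 < p)%N).
    have n1 : (i.+1%:R : rat) != 0 by rewrite pnatr_eq0.
    have n2 : ((k * p + i.+1)%:R : rat) != 0 by rewrite pnatr_eq0 addnS.
    have zx : (i.+1%:R)^-1 \in zloc p by apply: zlocV_nat.
    have zy : ((k * p + i.+1)%:R)^-1 \in zloc p by apply: zlocV_nat.
    have zk := zloc_nat p k; rewrite natrD natrM in n2 zy *.
    move: (i.+1%:R) (k%:R) n1 n2 zx zy zk => x y n1 n2 zx zy zk.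
    have -> : (y * p%:R + x)^-1 - (x^-1 - y * p%:R * x^-1 ^+ 2 + y ^+ 2 * p%:R ^+ 2 * x^-1 ^+ 3) =
       p%:R ^+ 3 * (- y ^+ 3 * x^-1 ^+ 3 * (y * p%:R + x)^-1).
      by field; rewrite ?n1 ?n2.
    by rewrite zid_mulr // !rpredM ?rpredX // rpredN rpredX.
  move=> h; set Y := \sum_(i < _) _ in h *.
  have -> : Y - (2%:R * k%:R + 1) * harmonic p.-1 =
     (Y - (harmonic p.-1 - k%:R * p%:R * invsum p 2 + k%:R ^+ 2 * p%:R ^+ 2 * invsum p 3))
     - k%:R * (2%:R * harmonic p.-1 + p%:R * invsum p 2)
     + p%:R ^+ 2 * invsum p 3 * k%:R ^+ 2 by ring.
  apply: rpredD; last first.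
    apply: zidMr; last by rewrite rpredX // zloc_nat.
    by rewrite [p%:R ^+ 3]exprSr; apply: zidM; [apply: zid_self | apply: invsum3_zid].
  by apply: rpredB => //; apply: zidMl; [apply: zloc_nat | apply: harmonic_invsum2].
elim: m => [|m IH]; first by rewrite mul0n /psum big_geq // expr0n mul0r subrr rpred0.
rewrite psum_block //; set Y := \sum_(i < _) _.
have -> : psum p (m * p) + Y - m.+1%:R ^+ 2 * harmonic p.-1 =
   (psum p (m * p) - m%:R ^+ 2 * harmonic p.-1) + (Y - (2%:R * m%:R + 1) * harmonic p.-1).
  by rewrite -natr1; ring.
by rewrite rpredD // block.
Qed.

(** * The congruence for the mirror series *)

Definition hdiff (N m : nat) : rat := harmonic (N * m) - harmonic m.

Lemma hdiff0 N : hdiff N 0 = 0.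
Proof. by rewrite /hdiff muln0 subrr. Qed.

Lemma hdiff_step p N b m : (0 < p)%N -> (b < p)%N ->
  p%:R * hdiff N (b + m * p) - hdiff N m =
    p%:R * (psum p (N * (b + m * p)) - psum p (b + m * p)) +
    \sum_(i < N * b %/ p) ((N * m + i.+1)%:R)^-1.
Proof.
move=> p0 bp; rewrite /hdiff mulrBr !harmonic_psum // mulnDMr // harmonicD.
have -> : ((b + m * p) %/ p = m)%N by rewrite addnC divnMDl // divn_small // addn0.
ring.
Qed.

Lemma hdiff_mul p N m : (0 < p)%N ->
  p%:R * hdiff N (m * p) - hdiff N m = p%:R * (psum p (N * m * p) - psum p (m * p)).
Proof.
move=> p0; have := hdiff_step N m p0 p0.
by rewrite muln0 div0n big_ord0 addr0 add0n mulnA.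
Qed.

Lemma zloc_multinom p N m : prime p -> multinom_coef N m \in zloc p.
Proof.
move=> pp; have [->|m0] := posnP m; first by rewrite multinom0 rpred1.
apply: zid_zloc (fact_dvd_multinom p N m0); last exact: zloc_nat.
by rewrite pnatr_eq0 -lt0n fact_gt0.
Qed.

Lemma zid_dvdn p (d n : nat) : (0 < d)%N -> (d %| n)%N -> n%:R \in zid p d%:R.
Proof. by move=> d0 /dvdnP[q ->]; rewrite natrM zid_mull // zloc_nat. Qed.

Lemma zid_fact p N (y x : rat) : prime p ->
  (x \in zid p (y * N`!%:R)) =
  (x \in zid p (y * (p%:R ^+ (N %/ p) * (N %/ p)`!%:R))).
Proof.
move=> pp; have u0 := pfact_neq0 N pp.
set z := y * (_ * _).
have -> : y * N`!%:R = z * (pfact p N)%:R.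
  by rewrite (fact_pfact N (prime_gt0 pp)) !natrM natrX /z; ring.
rewrite !zidE [(z * _)^-1]invfM mulrA; apply/idP/idP => h.
  by have := rpredM h (zloc_nat p (pfact p N)); rewrite divfK.
by rewrite rpredM // zlocV_pfact.
Qed.

(* The carries in [(N (b + m p))! / (b + m p)!^N] provide [N %/ p] powers of [p]
   in addition to those of [N!]: for [b > 1] because [N b %/ p >= 2 (N %/ p)],
   and for [m > 0] because [N!] already divides [multinom_coef N m]. *)
Lemma multinom_hdiff_generic p N b m : prime p -> (0 < b < p)%N ->
  (1 < b)%N || (0 < m)%N ->
  multinom_coef N (b + m * p) * (p%:R * hdiff N (b + m * p) - hdiff N m)
    \in zid p (p%:R ^+ maxn 1 (N %/ p) * N`!%:R).
Proof.
move=> pp /andP[b0 bp] bm; have p0 := prime_gt0 pp.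
have pR : (p%:R : rat) != 0 by rewrite pnatr_eq0 -lt0n.
rewrite hdiff_step // multinom_step //; set k := (N * b %/ p)%N; set n1 := (N %/ p)%N.
set U := pratio _ _ _; have Up : U \in zloc p by apply: zloc_pratio.
set B := multinom_coef N m; have Bp : B \in zloc p by apply: zloc_multinom.
set D := psum _ _ - psum _ _; have Dp : D \in zloc p by rewrite rpredB // zloc_psum.
set r := rising _ _.
have kn1 : (n1 <= k)%N by rewrite leq_div2r // -{1}(muln1 N) leq_mul2l b0 orbT.
have kk : (1 < b)%N -> (n1 + n1 <= k)%N.
  move=> b1; rewrite /k leq_divRL // mulnDl; have := leq_trunc_div N p; rewrite -/n1 => le.
  by apply: (@leq_trans (N * 2)); [rewrite muln2 -addnn leq_add | rewrite leq_mul2l b1 orbT].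
have F0 : (0 < n1`!)%N by rewrite fact_gt0.
(* Both kinds of summands have this shape: in the first the factor [p] raises the exponent to
   [k + 1], in the second a denominator cancels a factor of the rising product [r]. *)
suff main (e : nat) (c : rat) : (e <= k.+1)%N -> (1 <= e)%N ->
   (c \in zloc p) -> ((e = k.+1) \/ (0 < k)%N /\ e = k) ->
   ((1 < b)%N -> c \in zid p n1`!%:R) ->
   B * (p%:R ^+ e * c) * U \in zid p (p%:R ^+ maxn 1 n1 * N`!%:R).
  rewrite mulrDr; apply: rpredD.
    have -> : B * (p%:R ^+ k * r%:R) * U * (p%:R * D) = B * (p%:R ^+ k.+1 * (r%:R * D)) * U.
      by rewrite exprSr; ring.
    apply: main => //; [by rewrite rpredM // zloc_nat | by left |].
    by move=> _; apply: zidMr => //; apply: zid_dvdn => //; apply: fact_dvdn_rising.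
  rewrite mulr_sumr; apply: rpred_sum => i _.
  have ik := ltn_ord i.
  pose c := (rising (N * m) i * rising (N * m + i.+1) (k - i.+1))%N.
  have -> : B * (p%:R ^+ k * r%:R) * U * ((N * m + i.+1)%:R)^-1 = B * (p%:R ^+ k * c%:R) * U.
    have z0 : ((N * m + i.+1)%:R : rat) != 0 by rewrite pnatr_eq0 addnS.
    rewrite /r (rising_split _ ik) /c natrM natrM [in RHS]natrM.
    by move: ((N * m + i.+1)%:R : rat) z0 => z z0; field.
  apply: main => //; [by lia | by apply: zloc_nat | by right; split => //; lia |].
  move=> b1; apply: zid_dvdn => //; rewrite /c.
  have k2 := kk b1.
  (* Removing one of at least [2 * n1] consecutive factors leaves a run of [n1] on one side or the
     other. *)
  have [le|lt] := leqP n1 i; first by rewrite dvdn_mulr // fact_dvdn_rising.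
  by rewrite dvdn_mull // fact_dvdn_rising //; lia.
move=> ek e1 cp ecase cdiv; apply: zidMr => //.
case/orP: bm => [b1 | m0].
  have k2 := kk b1.
  apply: zidMl => //; rewrite zid_fact // -/n1 mulrA -exprD; apply: zidM; last exact: cdiv.
  apply: (@zid_exp p e) => //; last exact: zid_self.
  by rewrite /maxn; case: ifP => _; lia.
have [b1|b1] := leqP b 1; last first.
  have k2 := kk b1.
  apply: zidMl => //; rewrite zid_fact // -/n1 mulrA -exprD; apply: zidM; last exact: cdiv.
  apply: (@zid_exp p e) => //; last exact: zid_self.
  by rewrite /maxn; case: ifP => _; lia.
rewrite mulrC; apply: zidM; last exact: fact_dvd_multinom.
apply: zidMr => //; apply: (@zid_exp p e) => //; last exact: zid_self.
have kE : k = n1 by rewrite /k (_ : b = 1%N) ?muln1 //; lia.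
by rewrite /maxn; case: ifP => _; lia.
Qed.

(** * The series [F], [G] and [G / F] *)

Lemma mirror_F0 N : mirror_F N 0%N = 1.
Proof. exact: multinom0. Qed.

Lemma mirror_FL N : (mirror_F N : fps) * mirror_log N = mirror_G N.
Proof.
have FV : (mirror_F N : fps) * (fps_inv (mirror_F N) : fps) = 1.
  by apply: fpsP; apply: fps_mulV; rewrite mirror_F0 oner_eq0.
by rewrite -[mirror_log N]/((mirror_G N : fps) * (fps_inv (mirror_F N) : fps)) mulrCA FV mulr1.
Qed.

Lemma mirror_G0 N : mirror_G N 0%N = 0.
Proof. by rewrite /mirror_G muln0 subrr mul0r. Qed.

Lemma mirror_log0 N : mirror_log N 0%N = 0.
Proof. by rewrite /mirror_log /fps_div /fps_mul big_ord1 mirror_G0 mul0r. Qed.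

Definition mirror_defect (p N : nat) : fps :=
  fps_subst p (mirror_log N) - (mirror_log N : fps) *+ p.

Lemma mirror_defectE p N n :
  mirror_defect p N n = fps_subst p (mirror_log N) n - p%:R * mirror_log N n.
Proof. by rewrite /mirror_defect fps_coefB fps_coefMn mulr_natl. Qed.

(** Multiplication by [F(z) F(z^p)] clears the denominators and leaves
    [F(z) G(z^p) - p F(z^p) G(z)]. *)
Lemma mirror_defect_coef p N a K : (a < p)%N ->
  ((mirror_F N : fps) * fps_subst p (mirror_F N) * mirror_defect p N) (a + K * p)%N =
  \sum_(j < K.+1) multinom_coef N (a + j * p) * multinom_coef N (K - j) *
     (hdiff N (K - j) - p%:R * hdiff N (a + j * p)).
Proof.
move=> ap; have p0 : (0 < p)%N by apply: leq_trans ap.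
have -> : (mirror_F N : fps) * fps_subst p (mirror_F N) * mirror_defect p N =
    (mirror_F N : fps) * fps_subst p (mirror_G N) -
    ((mirror_G N : fps) * fps_subst p (mirror_F N)) *+ p.
  by rewrite -mirror_FL fps_substM // /mirror_defect; ring.
rewrite fps_coefB fps_coefMn !fps_coefM_subst // -[X in _ - X]mulr_natl mulr_sumr -sumrB.
by apply: eq_bigr => j _; rewrite /mirror_F /mirror_G /hdiff; ring.
Qed.

Lemma mirror_FF0 p N : ((mirror_F N : fps) * fps_subst p (mirror_F N)) 0%N = 1.
Proof. by rewrite fps_coefM big_ord1 /fps_subst dvdn0 div0n mirror_F0 mulr1. Qed.

Lemma zloc_mirror_FF p N i : prime p ->
  ((mirror_F N : fps) * fps_subst p (mirror_F N)) i \in zloc p.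
Proof.
move=> pp; apply: rpred_sum => j _; apply: rpredM; first exact: zloc_multinom.
by rewrite /fps_subst; case: ifP => _; [apply: zloc_multinom | rewrite rpred0].
Qed.

Section MirrorCongruence.

(** [M] is to be [p^(1+t)] with [t = Omega_exp p N] for [p <= N], and [p] for [p > N]. *)
Variables (p N : nat) (M : rat).
Hypothesis pp : prime p.
Hypothesis M0 : M != 0.
Hypothesis hW : forall m, p%:R * hdiff N (m * p) - hdiff N m \in zid p M.
Hypothesis h1 : p%:R * hdiff N 1 \in zid p M.
Hypothesis hn : p%:R ^+ maxn 1 (N %/ p) \in zid p M.

Let p0 : (0 < p)%N := prime_gt0 pp.
Let pR : (p%:R : rat) != 0. Proof. by rewrite pnatr_eq0 -lt0n. Qed.
Let F0 : (N`!%:R : rat) != 0. Proof. by rewrite pnatr_eq0 -lt0n fact_gt0. Qed.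

(** The hypotheses serve three cases: [hW] for [p] dividing [m], [h1] for [m = 1], and [hn] with
    [multinom_hdiff_generic] for all other [m]. *)
Lemma multinom_hdiff_zid m :
  multinom_coef N m * (p%:R * hdiff N m - hdiff N (m %/ p)) \in zid p (M * N`!%:R).
Proof.
have [->|m0] := posnP m; first by rewrite div0n hdiff0 mulr0 subrr mulr0 rpred0.
have mE : m = (m %% p + m %/ p * p)%N by rewrite addnC -divn_eq.
have mp : (m %% p < p)%N by rewrite ltn_pmod.
have [b0|b0] := posnP (m %% p)%N.
  have hm : m = (m %/ p * p)%N by rewrite {1}mE b0.
  have := hW (m %/ p); rewrite -hm => h; rewrite mulrC; apply: zidM => //.
  exact: fact_dvd_multinom.
have [bm|] := boolP ((1 < m %% p) || (0 < m %/ p))%N.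
  have := @multinom_hdiff_generic p N (m %% p) (m %/ p) pp; rewrite -mE b0 mp => /(_ isT bm) h.
  apply: zid_trans h _; first by rewrite mulf_neq0 // expf_neq0.
  by apply: zidM => //; apply: zid_self.
rewrite negb_or -!leqNgt leqn0 => /andP[b1 /eqP m'0].
have m1 : m = 1%N by rewrite mE m'0 mul0n addn0; apply/eqP; rewrite eqn_leq b1 b0.
rewrite m'0 hdiff0 subr0 m1 mulrC; apply: zidM => //.
exact: fact_dvd_multinom.
Qed.

Lemma hdiff_pow s m : p%:R ^+ s * hdiff N (m * p ^ s) - hdiff N m \in zid p M.
Proof.
elim: s => [|s IH]; first by rewrite expn0 muln1 expr0 mul1r subrr rpred0.
rewrite expnSr mulnA exprSr.
have -> : p%:R ^+ s * p%:R * hdiff N (m * p ^ s * p) - hdiff N m =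
  p%:R ^+ s * (p%:R * hdiff N (m * p ^ s * p) - hdiff N (m * p ^ s)) +
  (p%:R ^+ s * hdiff N (m * p ^ s) - hdiff N m) by ring.
by rewrite rpredD // zidMl // rpredX // zloc_nat.
Qed.

Lemma multinom_hdiff_pow s m :
  p%:R ^+ s.+1 * multinom_coef N m *
    (hdiff N (m * p ^ s) - hdiff N (m %/ p * p ^ s.+1)) \in zid p (M * N`!%:R).
Proof.
have [->|m0] := posnP m; first by rewrite div0n !mul0n subrr mulr0 rpred0.
have -> : p%:R ^+ s.+1 * multinom_coef N m *
    (hdiff N (m * p ^ s) - hdiff N (m %/ p * p ^ s.+1)) =
  (p%:R * (p%:R ^+ s * hdiff N (m * p ^ s) - hdiff N m) -
   (p%:R ^+ s.+1 * hdiff N (m %/ p * p ^ s.+1) - hdiff N (m %/ p))) * multinom_coef N m +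
  multinom_coef N m * (p%:R * hdiff N m - hdiff N (m %/ p)).
  by rewrite exprS; ring.
rewrite rpredD ?multinom_hdiff_zid //; apply: zidM; last exact: fact_dvd_multinom.
by apply: rpredB; [apply: zidMl; [apply: zloc_nat|] |]; apply: hdiff_pow.
Qed.

Let S (a K s m : nat) := dwork_sum p (multinom_coef N) a K s m.

(** Summation by parts: [hdiff] at the start of a block is replaced by its value at the start of the
    enclosing block of length [p^(s+1)]. The correction is controlled by [dwork_congruence] and
    [multinom_hdiff_pow]. At [d = 0] only [hdiff N 0 = 0] remains. *)
Lemma hdiff_by_parts a K d s : (a < p)%N ->
  \sum_(m < p ^ d) hdiff N (m * p ^ s) * S a K s m \in zid p (M * N`!%:R).
Proof.
move=> ap; elim: d s => [|d IH] s.
  by rewrite expn0 big_ord1 mul0n hdiff0 mul0r rpred0.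
have MN : M * N`!%:R != 0 by rewrite mulf_neq0.
rewrite (big_ord_mul (fun m => hdiff N (m * p ^ s) * S a K s m) (expnSr p d)).
have -> : \sum_(m < p ^ d) \sum_(i < p) hdiff N ((m * p + i) * p ^ s) * S a K s (m * p + i) =
  \sum_(m < p ^ d) \sum_(i < p) (hdiff N ((m * p + i) * p ^ s) - hdiff N (m * p ^ s.+1)) * S a K s (m * p + i)
  + \sum_(m < p ^ d) hdiff N (m * p ^ s.+1) * S a K s.+1 m.
  rewrite -big_split /=; apply: eq_bigr => m _.
  rewrite /S dwork_sumS mulr_sumr -big_split /=; apply: eq_bigr => i _; ring.
apply: rpredD; last exact: IH.
apply: rpred_sum => m _; apply: rpred_sum => i _.
set j := (m * p + i)%N.
have -> : (m : nat) = (j %/ p)%N by rewrite /j divnMDl // divn_small // addn0.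
have := @dwork_congruence p (multinom_coef N) a pp ap (multinom0 N) (multinom_neq0 N)
  (fun m => zloc_multinom N m pp) (fun s x n => @multinom_dwork p N s x n pp) K s j.
rewrite zidE; set e := _ / _ => ep.
have -> : S a K s j = p%:R ^+ s.+1 * multinom_coef N j * e.
  by rewrite /e mulrC divfK // mulf_neq0 ?expf_neq0 // multinom_neq0.
by rewrite mulrC mulrAC; apply: zidMr => //; apply: multinom_hdiff_pow.
Qed.

Lemma mirror_congruence_sum a K : (a < p)%N ->
  \sum_(j < K.+1) multinom_coef N (a + j * p) * multinom_coef N (K - j) *
     (hdiff N (K - j) - p%:R * hdiff N (a + j * p)) \in zid p (M * N`!%:R).
Proof.
move=> ap; pose B := multinom_coef N; pose h := hdiff N.
have aE (j : nat) : ((a + j * p) %/ p = j)%N by rewrite addnC divnMDl // divn_small // addn0.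
(* Replacing [p h(a + j p)] by [h(j)] costs a multiple of [M N!]. Reversing the index then turns the
   rest into a sum of [h(j)] against the Dwork terms. *)
have -> : \sum_(j < K.+1) B (a + j * p)%N * B (K - j)%N * (h (K - j)%N - p%:R * h (a + j * p)%N) =
  - \sum_(j < K.+1) B (a + j * p)%N * (p%:R * h (a + j * p)%N - h ((a + j * p) %/ p)%N) * B (K - j)%N
  + (\sum_(j < K.+1) B (a + j * p)%N * B (K - j)%N * h (K - j)%N
     - \sum_(j < K.+1) B (a + j * p)%N * B (K - j)%N * h j).
  rewrite -sumrN -sumrB -big_split /=; apply: eq_bigr => j _; rewrite aE; ring.
apply: rpredD.
  rewrite rpredN; apply: rpred_sum => j _; apply: zidMr; last exact: zloc_multinom.
  exact: multinom_hdiff_zid.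
have -> : \sum_(j < K.+1) B (a + j * p)%N * B (K - j)%N * h (K - j)%N =
   \sum_(j < K.+1) B j * B (a + (K - j) * p)%N * h j.
  rewrite (reindex_inj rev_ord_inj) /=; apply: eq_bigr => j _.
  by rewrite subSS subKn ?leq_ord // [B (_ + _)%N * _]mulrC.
have -> : \sum_(j < K.+1) B j * B (a + (K - j) * p)%N * h j -
   \sum_(j < K.+1) B (a + j * p)%N * B (K - j)%N * h j =
   - \sum_(j < p ^ K.+1) h (j * p ^ 0)%N * S a K 0 j.
  (* The range is extended to a power of [p]; the added terms vanish. *)
  have le : (K.+1 <= p ^ K.+1)%N by apply: ltnW; rewrite ltn_expl // prime_gt1.
  rewrite -(subnKC le) big_split_ord /= [X in _ = - (_ + X)]big1; last first.
    move=> j _; rewrite /S dwork_sum_high ?mulr0 // expn0 muln1.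
    by rewrite addSn ltnS leq_addr.
  rewrite addr0 -sumrB -sumrN; apply: eq_bigr => j _.
  rewrite /S /dwork_sum expn0 big_ord1 !muln1 addn0 /dwork_term leq_ord /B; ring.
by rewrite rpredN hdiff_by_parts.
Qed.

(** The factor [F(z) F(z^p)] is integral at [p] with constant term 1, so it can be cancelled by
    induction on the coefficient. *)
Lemma mirror_log_zid n :
  fps_subst p (mirror_log N) n - p%:R * mirror_log N n \in zid p (M * N`!%:R).
Proof.
rewrite -mirror_defectE; elim/ltn_ind: n => n IH.
have : ((mirror_F N : fps) * fps_subst p (mirror_F N) * mirror_defect p N) n
    \in zid p (M * N`!%:R).
  rewrite (divn_eq n p) addnC mirror_defect_coef ?ltn_pmod //.
  by apply: mirror_congruence_sum; rewrite ltn_pmod.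
rewrite fps_coefM big_ord_recl subn0 mirror_FF0 mul1r; set T := \sum_(i < n) _ => h.
rewrite -(addrK T (mirror_defect p N n)) rpredB //; apply: rpred_sum => i _.
apply: zidMl; first exact: zloc_mirror_FF.
by apply: IH; rewrite lift0; have := ltn_ord i; lia.
Qed.

End MirrorCongruence.

(** * Valuations of harmonic numbers *)

Lemma pinv_notin_zloc p : prime p -> (p%:R)^-1 \notin zloc p.
Proof.
move=> pp; apply/negP => /zlocP[d pd /intrP[z E]].
have pR : (p%:R : rat) != 0 by rewrite pnatr_eq0 -lt0n prime_gt0.
have : (d%:Z)%:~R = (p%:Z * z)%:~R :> rat.
  by rewrite rmorphM /= -E -[p%:~R]/(p%:R) mulrA mulfV // mul1r.
move/intr_inj/(congr1 absz); rewrite abszM !absz_nat => dE.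
by move: pd; rewrite prime_coprime // dE dvdn_mulr.
Qed.

Lemma padic_val_decomp p (x : rat) : prime p -> x != 0 ->
  exists u, [/\ u != 0, u \in zloc p, u^-1 \in zloc p & x = p%:R ^ padic_val p x * u].
Proof.
move=> pp x0; have pR : (p%:R : rat) != 0 by rewrite pnatr_eq0 -lt0n prime_gt0.
have n0 : (0 < `|numq x|)%N by rewrite absz_gt0 numq_eq0.
have d0 : (0 < `|denq x|)%N by rewrite absz_gt0 denq_neq0.
have [a pa aE] := pfactor_coprime pp n0; have [b pb bE] := pfactor_coprime pp d0.
have nE : (numq x)%:~R = (-1) ^+ (numq x < 0)%R * (`|numq x|%N)%:R :> rat.
  rewrite -[(`|numq x|%N)%:R]/((`|numq x|%N%:Z)%:~R) {1}[numq x]intEsign rmorphM /=.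
  by rewrite rmorph_sign.
have dE : (denq x)%:~R = (`|denq x|%N)%:R :> rat.
  by rewrite -[(`|denq x|%N)%:R]/((`|denq x|%N%:Z)%:~R) absz_denq.
have a0 : (a%:R : rat) != 0.
  by rewrite pnatr_eq0; apply: contraTneq n0 => a0; rewrite aE a0 mul0n.
have b0 : (b%:R : rat) != 0.
  by rewrite pnatr_eq0; apply: contraTneq d0 => b0; rewrite bE b0 mul0n.
exists ((-1) ^+ (numq x < 0)%R * (a%:R / b%:R)); split.
- by rewrite mulf_neq0 ?signr_eq0 // mulf_neq0 ?invr_eq0.
- by rewrite rpredM ?rpredX ?rpredN ?rpred1 // rpredM ?zloc_nat ?zlocV_nat.
- by rewrite invfM invf_div rpredM ?rpredM ?zloc_nat ?zlocV_nat // -exprVn invrN1 rpredX // rpredN rpred1.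
rewrite -{1}(divq_num_den x) nE dE {1}aE {1}bE /padic_val expfzDr // -invr_expz -!exprnP !natrM !natrX.
by field; rewrite b0 expf_neq0.
Qed.

Lemma zid_padic_val p (x : rat) (z : int) : prime p -> x != 0 ->
  (x \in zid p (p%:R ^ z)) = (z <= padic_val p x).
Proof.
move=> pp x0; have pR : (p%:R : rat) != 0 by rewrite pnatr_eq0 -lt0n prime_gt0.
have [u [u0 up uV {1}->]] := padic_val_decomp pp x0; set v := padic_val p x.
have -> : (p%:R ^ v * u \in zid p (p%:R ^ z)) = (p%:R ^ (v - z) \in zloc p).
  rewrite zidE mulrAC invr_expz -expfzDr //; apply/idP/idP => h; last exact: rpredM.
  by rewrite -(mulfK u0 (_ ^ _)) rpredM.
rewrite -[RHS]subr_ge0; case: (v - z) => n; first by rewrite rpredX // zloc_nat.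
apply/negbTE; apply: contra (pinv_notin_zloc pp); rewrite NegzE -invr_expz -exprnP => h.
have -> : (p%:R : rat)^-1 = (p%:R ^+ n.+1)^-1 * p%:R ^+ n.
  by rewrite exprS invfM mulfVK // expf_neq0.
by rewrite rpredM // rpredX // zloc_nat.
Qed.

Lemma zid_expz p (x : rat) (y z : int) : prime p -> y <= z ->
  x \in zid p (p%:R ^ z) -> x \in zid p (p%:R ^ y).
Proof.
move=> pp yz; have [->|x0] := eqVneq x 0; first by rewrite !rpred0.
by rewrite !zid_padic_val //; apply: le_trans.
Qed.

(** Division by [i.+1] loses its [p]-part [g], hence the modulus [p ^ f * g]. The coprimality test
    ensures that [g] is the whole [p]-part. *)
Definition cert_ok (p e f : nat) (cs : seq nat) (n : nat) : bool :=
  all (fun i => let g := gcdn i.+1 (p ^ e) in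
    coprime p (i.+1 %/ g) && (i.+1 * nth 0%N cs i == p ^ e %[mod p ^ f * g])%N)
    (iota 0 n).

Definition cert_sum (cs : seq nat) (n : nat) : nat :=
  foldr (fun i s => nth 0%N cs i + s)%N 0%N (iota 0 n).

(* [cs] lists the residues of [p ^ e / i] modulo [p ^ f]. *)
Lemma harmonic_cert p e f g n r cs : prime p -> cert_ok p e f cs n -> (e + g <= f)%N ->
  harmonic n - r%:R \in zid p (p%:R ^+ g) ->
  (cert_sum cs n == p ^ e * r %[mod p ^ (e + g)])%N.
Proof.
move=> pp ok efg hn; have p0 := prime_gt0 pp.
have pR : (p%:R : rat) != 0 by rewrite pnatr_eq0 -lt0n.
have S : p%:R ^+ e * harmonic n - (cert_sum cs n)%:R \in zid p (p%:R ^+ f).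
  have -> : (cert_sum cs n)%:R = \sum_(i < n) (nth 0%N cs i)%:R :> rat.
    rewrite /cert_sum -(big_mkord xpredT (fun i => (nth 0%N cs i)%:R)) /index_iota subn0.
    by elim: (iota 0 n) => [|i s IH] /=; rewrite ?big_nil // big_cons natrD IH.
  rewrite harmonicE mulr_sumr -sumrB; apply: rpred_sum => i _.
  move/allP: ok => /(_ i); rewrite mem_iota /= add0n ltn_ord => /(_ isT) /andP[cop /eqP ci].
  set G := gcdn i.+1 (p ^ e) in cop ci.
  have G0 : (0 < G)%N by rewrite gcdn_gt0.
  have iE : i.+1%:R = G%:R * (i.+1 %/ G)%:R :> rat by rewrite -natrM mulnC divnK // dvdn_gcdl.
  have GR : (G%:R : rat) != 0 by rewrite pnatr_eq0 -lt0n.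
  have iR : (i.+1%:R : rat) != 0 by rewrite pnatr_eq0.
  have kR : ((i.+1 %/ G)%:R : rat) != 0 by apply: contraNneq iR => k0; rewrite iE k0 mulr0.
  have -> : p%:R ^+ e * i.+1%:R^-1 - (nth 0%N cs i)%:R =
      - ((i.+1 * nth 0%N cs i)%:R - (p ^ e)%:R) * G%:R^-1 * (i.+1 %/ G)%:R^-1 :> rat.
    by rewrite natrM natrX -mulrA -invfM -iE; move: (i.+1%:R : rat) iR {iE} => y y0; field.
  apply: zidMr; last exact: zlocV_nat.
  rewrite mulNr rpredN -(zid_mul2l _ _ _ GR) mulrC divfK // mulrC -natrX -natrM.
  by apply: zid_modn => //; rewrite muln_gt0 expn_gt0 p0.
have {}S : p%:R ^+ e * harmonic n - (cert_sum cs n)%:R \in zid p (p%:R ^+ (e + g)).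
  exact: zid_exp S.
have : (cert_sum cs n)%:R - (p ^ e * r)%:R \in zid p (p%:R ^+ (e + g)).
  have -> : (cert_sum cs n)%:R - (p ^ e * r)%:R =
    p%:R ^+ e * (harmonic n - r%:R) - (p%:R ^+ e * harmonic n - (cert_sum cs n)%:R) :> rat.
    by rewrite natrM natrX; ring.
  by rewrite rpredB // exprD; apply: zidM => //; apply: zid_self.
have nat_zid (a b : nat) : (b <= a)%N -> a%:R - b%:R \in zid p (p%:R ^+ (e + g)) ->
    (a == b %[mod p ^ (e + g)])%N.
  move=> ba; rewrite eqn_mod_dvd // -natrB // zidE => /zlocP[d pd /intrP[z E]].
  have q0 : ((p ^ (e + g))%:R : rat) != 0 by rewrite pnatr_eq0 -lt0n expn_gt0 p0.
  have : ((a - b) * d)%N%:Z%:~R = ((p ^ (e + g))%N%:Z * z)%:~R :> rat.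
    rewrite [RHS]intrM -E -[(p ^ _)%N%:~R]/((p ^ (e + g))%:R) -[(_ * d)%N%:~R]/(((a - b) * d)%:R).
    by rewrite natrM -natrX [LHS]mulrC mulrCA mulrA mulfVK // mulrC.
  move/intr_inj/(congr1 absz); rewrite abszM !absz_nat => dE.
  rewrite -(@Gauss_dvdl _ _ d); last by rewrite coprimeXl.
  by rewrite dE dvdn_mulr.
have [le|lt] := leqP (p ^ e * r) (cert_sum cs n); first exact: nat_zid.
by rewrite -opprB rpredN eq_sym; apply: nat_zid; apply: ltnW.
Qed.

(** The residues of [27 / i] modulo 243 for [1 <= i <= 68], where 68 is the largest [n] with
    [n %/ 3 = 22]. *)
Definition cert3 : seq nat :=
  [:: 27; 135; 9; 189; 54; 126; 108; 216; 3; 27; 135; 63; 189; 54; 99; 108;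
      216; 123; 27; 135; 36; 189; 54; 153; 108; 216; 1; 27; 135; 171; 189;
      54; 45; 108; 216; 183; 27; 135; 225; 189; 54; 18; 108; 216; 195; 27;
      135; 198; 189; 54; 72; 108; 216; 122; 27; 135; 90; 189; 54; 207; 108;
      216; 174; 27; 135; 144; 189; 54].

(** The residues of [11 / i] modulo 121 for [1 <= i <= 43], where 43 is the largest [n] with
    [n %/ 11 = 3]. *)
Definition cert11 : seq nat :=
  [:: 11; 66; 44; 33; 99; 22; 88; 77; 55; 110; 1; 11; 66; 44; 33; 99; 22;
      88; 77; 55; 110; 61; 11; 66; 44; 33; 99; 22; 88; 77; 55; 110; 81; 11;
      66; 44; 33; 99; 22; 88; 77; 55; 110].

Lemma cert3_ok n : (n <= 68)%N -> cert_ok 3 3 5 cert3 n.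
Proof.
have : cert_ok 3 3 5 cert3 68 by vm_compute.
move=> /allP ok le; apply/allP => i; rewrite mem_iota /= add0n => ii.
by apply: ok; rewrite mem_iota /= add0n (leq_trans ii).
Qed.

Lemma cert11_ok n : (n <= 43)%N -> cert_ok 11 1 2 cert11 n.
Proof.
have : cert_ok 11 1 2 cert11 43 by vm_compute.
move=> /allP ok le; apply/allP => i; rewrite mem_iota /= add0n => ii.
by apply: ok; rewrite mem_iota /= add0n (leq_trans ii).
Qed.

(** By [harmonic_psum], [H_{n/p}] is [p H_n] minus a multiple of [p]. This is the descent step of
    the following lemmas. *)
Lemma harmonic_div_zid p n : prime p -> (harmonic n - 1 \in zloc p) ->
  harmonic (n %/ p) \in zid p p%:R.
Proof.
move=> pp hn; have := harmonic_psum n (prime_gt0 pp).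
have -> : p%:R * harmonic n = p%:R * (harmonic n - 1) + p%:R by ring.
move=> E; rewrite -(addrK (p%:R * psum p n) (harmonic (n %/ p))) -E.
by rewrite rpredB ?rpredD ?zid_mulr ?zid_self ?zloc_psum.
Qed.

(** Halving [n] repeatedly ends at [H_1 = 1], which would have to be even. *)
Lemma harmonic_notin_zloc2 n : (1 < n)%N -> harmonic n \notin zloc 2.
Proof.
elim/ltn_ind: n => n IH n1; apply/negP => hn.
have : harmonic (n %/ 2) \in zid 2 2%:R by apply: harmonic_div_zid => //; rewrite rpredB.
have [n2|n2] := ltnP 1 (n %/ 2).
  move=> h; have := zid_zloc (_ : 2%:R != 0) (zloc_nat 2 2) h; rewrite pnatr_eq0 => /(_ isT).
  by apply/negP; apply: IH => //; rewrite ltn_Pdiv // ltnW.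
have -> : (n %/ 2 = 1)%N by apply/eqP; rewrite eqn_leq n2 divn_gt0.
rewrite harmonicE big_ord1 zidE invr1 mul1r.
by apply/negP; apply: pinv_notin_zloc.
Qed.

(** By descent [n %/ 3] is 0 or again in the list, so [n <= 68], and a finite computation
    decides. *)
Lemma harmonic_zid3 n : (0 < n)%N -> harmonic n \in zid 3 3%:R -> n \in [:: 2; 7; 22]%N.
Proof.
elim/ltn_ind: n => n IH n0 hn.
have fin : (n <= 68)%N -> n \in [:: 2; 7; 22]%N.
  move=> le; have := @harmonic_cert 3 3 5 1 n 0 cert3 isT (cert3_ok le) isT.
  rewrite subr0 expr1 => /(_ hn); move: n0 le; clear.
  have : all (fun n => (cert_sum cert3 n == 3 ^ 3 * 0 %[mod 3 ^ (3 + 1)])%N ==> (n \in [:: 2; 7; 22]%N)) (iota 1 68) by vm_compute.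
  by move=> /allP H n0 le; have := H n; rewrite mem_iota n0 /= => /(_ le) /implyP.
have [n3|n3] := posnP (n %/ 3)%N.
  by apply: fin; rewrite (divn_eq n 3) n3 mul0n add0n; have := ltn_pmod n (isT : (0 < 3)%N); lia.
have hz : harmonic n - 1 \in zloc 3.
  by rewrite rpredB // ?rpred1 //; apply: zid_zloc hn; rewrite ?zloc_nat.
have := IH (n %/ 3)%N _ n3 (harmonic_div_zid (isT : prime 3) hz).
rewrite ltn_Pdiv // => /(_ isT) h; rewrite !inE in h.
apply: fin; have := divn_eq n 3; have := ltn_pmod n (isT : (0 < 3)%N).
by case/or3P: h => /eqP ->; lia.
Qed.

Lemma harmonic_sub1_zid9 n : (2 < n)%N -> harmonic n - 1 \notin zid 3 (3%:R ^+ 2).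
Proof.
move=> n2; apply/negP => hn.
have n3 : (0 < n %/ 3)%N by rewrite divn_gt0.
have hz : harmonic n - 1 \in zloc 3 by apply: zid_zloc hn; rewrite ?rpredX ?zloc_nat.
have h := harmonic_zid3 n3 (harmonic_div_zid (isT : prime 3) hz).
have le : (n <= 68)%N.
  have := divn_eq n 3; have := ltn_pmod n (isT : (0 < 3)%N).
  by move: h; rewrite !inE => /or3P[] /eqP ->; lia.
have := @harmonic_cert 3 3 5 2 n 1 cert3 isT (cert3_ok le) isT hn.
have : all (fun n => ((n %/ 3)%N \in [:: 2; 7; 22]%N) ==> (cert_sum cert3 n != 3 ^ 3 * 1 %[mod 3 ^ (3 + 2)])%N) (iota 0 69) by vm_compute.
by move=> /allP /(_ n); rewrite mem_iota h /= => /(_ le) /negbTE ->.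
Qed.

Lemma harmonic_sub1_zid11 n : (n %/ 11 = 3)%N -> harmonic n - 1 \notin zid 11 11%:R.
Proof.
move=> n3; apply/negP => hn.
have le : (n <= 43)%N.
  by have := divn_eq n 11; have := ltn_pmod n (isT : (0 < 11)%N); lia.
have := @harmonic_cert 11 1 2 1 n 1 cert11 isT (cert11_ok le) isT.
rewrite expr1 => /(_ hn).
have : all (fun n : nat => (n %/ 11 == 3)%N ==> (cert_sum cert11 n != 11 ^ 1 * 1 %[mod 11 ^ (1 + 1)])%N) (iota 0 44) by vm_compute.
by move=> /allP /(_ n); rewrite mem_iota n3 /= => /(_ le) /negbTE ->.
Qed.

Lemma zid_nat_dvdn p n : prime p -> n%:R \in zid p p%:R -> (p %| n)%N.
Proof.
move=> pp np; apply: contraT => pn; have := zlocV_nat (_ : coprime p n).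
rewrite prime_coprime // => /(_ pn) nV.
have : 1 \in zid p p%:R.
  have n0 : (n%:R : rat) != 0 by rewrite pnatr_eq0; apply: contraNneq pn => ->.
  by have := zidMr np nV; rewrite mulfV.
by rewrite zidE mul1r (negbTE (pinv_notin_zloc pp)).
Qed.

Lemma harmonic_gt0 n : (0 < n)%N -> 0 < harmonic n.
Proof.
case: n => // n _; rewrite harmonicE big_ord_recl ltr_wpDr ?invr1 //.
by apply: sumr_ge0 => i _; rewrite invr_ge0 ler0n.
Qed.

Lemma harmonic_sub1_gt0 n : (1 < n)%N -> 0 < harmonic n - 1.
Proof.
case: n => [|[|n]] // _; rewrite harmonicE !big_ord_recl invr1 addrAC subrr add0r.
apply: ltr_wpDr; last by rewrite invr_gt0 ltr0n.
by apply: sumr_ge0 => i _; rewrite invr_ge0 ler0n.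
Qed.

Lemma padic_val_harmonic_sub1 p n (z : int) : prime p -> (1 < n)%N ->
  (harmonic n - 1 \in zid p (p%:R ^ z)) = (z <= padic_val p (harmonic n - 1)).
Proof. by move=> pp n1; rewrite zid_padic_val // gt_eqF // harmonic_sub1_gt0. Qed.

(** * The exponent of Omega *)

Definition Omega_exp (p N : nat) : int :=
  Num.min (2 + (omega p N)%:Z) (padic_val p (harmonic N - 1)).

Lemma omega_le1 p N : (omega p N <= 1)%N.
Proof. by rewrite /omega; case: ifP. Qed.

Lemma Omega_exp_le p N (z : int) : padic_val p (harmonic N - 1) <= z -> Omega_exp p N <= z.
Proof. by move=> h; rewrite /Omega_exp ge_min h orbT. Qed.

Lemma Omega_exp_le3 p N : Omega_exp p N <= 3.
Proof.
rewrite /Omega_exp ge_min; apply/orP; left.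
by have := omega_le1 p N; lia.
Qed.

Lemma padic_val2_harmonic n : (1 < n)%N -> padic_val 2 (harmonic n - 1) < 0.
Proof.
move=> n1; rewrite ltNge -padic_val_harmonic_sub1 // expr0z zid1; apply/negP => h.
have := harmonic_notin_zloc2 n1; rewrite -(subrK 1 (harmonic n)).
by rewrite rpredD ?rpred1.
Qed.

Lemma padic_val3_harmonic n : (2 < n)%N -> padic_val 3 (harmonic n - 1) < 2.
Proof.
move=> n2; rewrite ltNge -padic_val_harmonic_sub1 //; last exact: ltnW.
by rewrite -[_ ^ 2]/(_ ^+ 2) harmonic_sub1_zid9.
Qed.

(** As the exponent is at most 3, only [N %/ p <= 3] needs an argument. Unless the valuation is
    negative, [p] divides [H_{N/p}]: impossible for [H_1 = 1], while [H_2 = 3/2] forces [p = 3] and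
    [H_3 = 11/6] forces [p = 11], where the finite computations apply. *)
Lemma Omega_exp_lt_div p N : prime p -> (1 < N)%N -> (p <= N)%N ->
  1 + Omega_exp p N <= (N %/ p)%:Z.
Proof.
move=> pp N1 pN; have n0 : (0 < N %/ p)%N by rewrite divn_gt0 ?prime_gt0.
have t3 := Omega_exp_le3 p N.
have [v0|v0] := ltP (padic_val p (harmonic N - 1)) 0.
  by have := @Omega_exp_le p N (-1); lia.
have H : harmonic (N %/ p) \in zid p p%:R.
  by apply: harmonic_div_zid => //; rewrite -zid1 -(expr0z p%:R) padic_val_harmonic_sub1.
have [n4|n4] := leqP 4 (N %/ p); first by lia.
have [n1|[n2|n3]] : (N %/ p = 1 \/ N %/ p = 2 \/ N %/ p = 3)%N by lia.
- move: H; rewrite n1 harmonicE big_ord1 invr1 => /(@zid_nat_dvdn _ 1 pp).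
  by rewrite dvdn1 => /eqP p1; rewrite p1 in pp.
- move: H; rewrite n2 harmonicE !big_ord_recl big_ord0 addr0 => H.
  have : 3%:R \in zid p p%:R.
    have -> : 3%:R = ((1%:R)^-1 + (2%:R)^-1) * 2%:R :> rat by [].
    by apply: zidMr (zloc_nat _ _).
  move/(zid_nat_dvdn pp); rewrite dvdn_prime2 // => /eqP p3; rewrite p3 in pN *.
  by have := Omega_exp_le (ltW (padic_val3_harmonic pN)); have := padic_val3_harmonic pN;
     have := @Omega_exp_le 3 N 1; lia.
move: H; rewrite n3 harmonicE !big_ord_recl big_ord0 addr0 => H.
have : 11%:R \in zid p p%:R.
  have -> : 11%:R = ((1%:R)^-1 + ((2%:R)^-1 + (3%:R)^-1)) * 6%:R :> rat by [].
  by apply: zidMr (zloc_nat _ _).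
move/(zid_nat_dvdn pp); rewrite dvdn_prime2 // => /eqP p11; rewrite p11 in n3 *.
have := harmonic_sub1_zid11 n3.
rewrite -[X in zid _ X]expr1z padic_val_harmonic_sub1 // => h.
by have := @Omega_exp_le 11 N 0; lia.
Qed.

Lemma psum_diff p N m : prime p -> (4 < p)%N ->
  psum p (N * m * p) - psum p (m * p) -
    m%:R ^+ 2 * (N%:R ^+ 2 - 1) * harmonic p.-1 \in zid p (p%:R ^+ 3).
Proof.
move=> pp p4; have -> : psum p (N * m * p) - psum p (m * p) -
    m%:R ^+ 2 * (N%:R ^+ 2 - 1) * harmonic p.-1 =
  (psum p (N * m * p) - (N * m)%:R ^+ 2 * harmonic p.-1) -
  (psum p (m * p) - m%:R ^+ 2 * harmonic p.-1) by rewrite natrM; ring.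
by rewrite rpredB // psum_mul.
Qed.

Lemma wolstenholme_primeE p : prime p -> (2 < p)%N ->
  wolstenholme_prime p = (harmonic p.-1 \in zid p (p%:R ^+ 3)).
Proof.
move=> pp p2; rewrite /wolstenholme_prime pp /= -[_ ^+ 3]/(_ ^ 3) zid_padic_val //.
by rewrite gt_eqF // harmonic_gt0; lia.
Qed.

Lemma sqr_sub1_zid p N : prime p ->
  (N%:Z == 1 %[mod p%:Z])%Z || (N%:Z == -1 %[mod p%:Z])%Z =
  (N%:R ^+ 2 - 1 \in zid p p%:R).
Proof.
move=> pp; rewrite !eqz_mod_dvd opprK.
have pE : (p%:R : rat) = (p%:Z)%:~R by [].
have NE : (N%:R : rat) = (N%:Z)%:~R by [].
have fac : N%:R ^+ 2 - 1 = (N%:Z - 1)%:~R * (N%:Z + 1)%:~R :> rat.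
  by rewrite rmorphB rmorphD /= -NE; ring.
apply/idP/idP => [/orP[] /dvdzP[q E]|].
- by rewrite fac E rmorphM /= -pE mulrAC zid_mull // -intrM zloc_int.
- by rewrite fac E rmorphM /= -pE mulrA zid_mull // -intrM zloc_int.
rewrite fac -intrM => h.
have : (p%:Z %| (N%:Z - 1) * (N%:Z + 1))%Z.
  set z := _ * _ in h *.
  have : `|z|%N%:R \in zid p p%:R.
    have -> : `|z|%N%:R = (-1) ^+ (z < 0)%R * z%:~R :> rat.
      by rewrite -[LHS]/((`|z|%N%:Z)%:~R) abszE normrEsign rmorphM /= rmorph_sign.
    by apply: zidMl => //; rewrite rpredX // rpredN rpred1.
  by move/(zid_nat_dvdn pp); rewrite dvdzE absz_nat.
by rewrite !dvdzE abszM absz_nat Euclid_dvdM.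
Qed.

Lemma hdiff_mul_zid p N m : prime p -> (1 < N)%N -> (p <= N)%N ->
  p%:R * hdiff N (m * p) - hdiff N m \in zid p (p%:R ^ (1 + Omega_exp p N)).
Proof.
move=> pp N1 pN; have p0 := prime_gt0 pp; rewrite hdiff_mul //.
set D := psum _ _ - psum _ _; set t := Omega_exp p N.
(* The exponent [e] is 0 for [p = 2], 1 for [p = 3] and [2 + omega p N] for larger [p]. *)
suff [e te De] : exists2 e : nat, t <= e%:Z & D \in zid p (p%:R ^+ e).
  apply: (@zid_expz p _ _ (e.+1)%:Z) => //; first by lia.
  by rewrite -exprnP exprS; apply: zidM => //; apply: zid_self.
have Dp : D \in zloc p by rewrite rpredB ?zloc_psum.
have [p2|] := even_prime pp.
  exists 0%N; last by rewrite expr0 zid1.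
  by rewrite /t p2; apply: Omega_exp_le; apply: ltW; apply: padic_val2_harmonic.
move=> podd; have p2 : (2 < p)%N by rewrite odd_prime_gt2.
have [p4|p4] := ltnP 4 p; last first.
  have p3 : p = 3%N by case: (p) pp podd p2 p4 => [|[|[|[|[|]]]]].
  exists 1%N; last by rewrite expr1 rpredB ?psum_mul_zid.
  have : padic_val p (harmonic N - 1) < 2 by rewrite p3; apply: padic_val3_harmonic; rewrite -p3.
  by move=> h; apply: Omega_exp_le; lia.
exists (2 + omega p N)%N.
  by rewrite /t /Omega_exp ge_min PoszD lexx.
have := psum_diff N m pp p4; rewrite -/D => hD.
have o3 : (2 + omega p N <= 3)%N by have := omega_le1 p N; lia.
rewrite -(subrK (m%:R ^+ 2 * (N%:R ^+ 2 - 1) * harmonic p.-1) D).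
apply: rpredD; first exact: zid_exp hD.
have w := wolstenholme pp p4.
have N2 : N%:R ^+ 2 - 1 \in zloc p by rewrite rpredB ?rpred1 ?rpredX ?zloc_nat.
have m2 : m%:R ^+ 2 \in zloc p by rewrite rpredX ?zloc_nat.
rewrite -mulrA; apply: zidMl => //; rewrite /omega.
have [W|W /=] := boolP (wolstenholme_prime p).
  by rewrite /=; apply: zidMl => //; rewrite -wolstenholme_primeE.
case: ifP => [|_]; last by apply: zidMl.
by rewrite sqr_sub1_zid // => NN; rewrite exprS; apply: zidM.
Qed.

Lemma mirror_log_zid_small p N n : prime p -> (1 < N)%N -> (p <= N)%N ->
  fps_subst p (mirror_log N) n - p%:R * mirror_log N n
    \in zid p (p%:R ^ (1 + Omega_exp p N) * N`!%:R).
Proof.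
move=> pp N1 pN; have p0 := prime_gt0 pp.
have pR : (p%:R : rat) != 0 by rewrite pnatr_eq0 -lt0n.
apply: mirror_log_zid => //.
- by rewrite expfz_neq0.
- by move=> m; apply: hdiff_mul_zid.
- rewrite expfzDr // expr1z /hdiff muln1 [harmonic 1]harmonicE big_ord1 invr1.
  by apply: zidM; [apply: zid_self | rewrite padic_val_harmonic_sub1 // ge_min lexx orbT].
apply: (@zid_expz p _ _ (maxn 1 (N %/ p))%:Z) => //; last exact: zid_self.
by have := Omega_exp_lt_div pp N1 pN; lia.
Qed.

Lemma mirror_log_zid_large p N n : prime p -> (N < p)%N ->
  fps_subst p (mirror_log N) n - p%:R * mirror_log N n \in zid p (p%:R * N`!%:R).
Proof.
move=> pp Np; have p0 := prime_gt0 pp.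
have pR : (p%:R : rat) != 0 by rewrite pnatr_eq0 -lt0n.
apply: mirror_log_zid => //.
- by move=> m; rewrite hdiff_mul // zid_mulr // rpredB ?zloc_psum.
- have := hdiff_step N 0 p0 (prime_gt1 pp); rewrite hdiff0 subr0 mul0n addn0 => ->.
  by rewrite muln1 divn_small // big_ord0 addr0 zid_mulr // rpredB ?zloc_psum.
by rewrite divn_small // zid_self.
Qed.

Lemma zloc_prime_expz p q (z : int) : prime p -> prime q -> q != p -> q%:R ^ z \in zloc p.
Proof.
move=> pp qq qp; have cq : coprime p q.
  by rewrite prime_coprime // dvdn_prime2 // eq_sym.
case: z => n; first by rewrite rpredX ?zloc_nat.
by rewrite NegzE -invr_expz -exprnP -exprVn rpredX // zlocV_nat.
Qed.

(** Powers of the other primes are units of [Z_(p)], also for negative exponents. *)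
Lemma Omega_decomp p N : prime p -> exists w, [/\ w != 0, w \in zloc p, w^-1 \in zloc p &
  Omega N = (if (p <= N)%N then p%:R ^ Omega_exp p N else 1) * w].
Proof.
move=> pp.
pose P (q : 'I_N.+1) := prime q && (q != p :> nat).
pose W (P : pred 'I_N.+1) : rat := \prod_(q < N.+1 | P q) q%:R ^ Omega_exp q N.
have WP (Q : pred 'I_N.+1) : (forall q, Q q -> P q) ->
    [/\ W Q != 0, W Q \in zloc p & (W Q)^-1 \in zloc p].
  move=> QP; split.
  - apply/prodf_neq0 => q /QP /andP[qq _].
    by rewrite expfz_neq0 // pnatr_eq0 -lt0n prime_gt0.
  - by apply: rpred_prod => q /QP /andP[qq qp]; apply: zloc_prime_expz.
  rewrite /W -prodfV; apply: rpred_prod => q /QP /andP[qq qp].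
  by rewrite invr_expz; apply: zloc_prime_expz.
have [pN|pN] := leqP p N.
  exists (W P); have [w0 wp wV] := WP P (fun q h => h); split => //.
  rewrite /Omega (bigD1 (Ordinal (pN : (p < N.+1)%N))) //=.
exists (W (fun q => prime q)); have [|w0 wp wV] := WP (fun q : 'I_N.+1 => prime q).
  by move=> q qq; rewrite /P qq /=; apply: contraTneq (ltn_ord q) => ->; rewrite ltnS -ltnNge.
by rewrite mul1r.
Qed.

(** * Integrality and maximality *)

Lemma qtilde_pow_zloc p N (c : rat) : prime p -> c != 0 ->
  (forall n, qtilde_pow N c^-1 n \in zloc p) <->
  (forall n, fps_subst p (mirror_log N) n - p%:R * mirror_log N n \in zid p (p%:R * c)).
Proof.
move=> pp c0.
have g0 : fps_scale c^-1 (mirror_log N) 0%N = 0 by rewrite /fps_scale mirror_log0 mulr0.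
rewrite /qtilde_pow dwork_exp //.
have E n : fps_subst p (fps_scale c^-1 (mirror_log N)) n - p%:R * fps_scale c^-1 (mirror_log N) n
    = c^-1 * (fps_subst p (mirror_log N) n - p%:R * mirror_log N n).
  by rewrite /fps_subst /fps_scale; case: ifP => _; ring.
have E2 x : (c^-1 * x \in zid p p%:R) = (x \in zid p (p%:R * c)).
  by rewrite -(zid_mul2l _ _ _ c0) mulVKf // mulrC.
by split=> h n; have := h n; rewrite E E2.
Qed.

Lemma mirror_log1 N : mirror_log N 1%N = (harmonic N - 1) * N`!%:R.
Proof.
have := congr1 (fun f : fps => f 1%N) (mirror_FL N).
rewrite fps_coefM !big_ord_recl big_ord0 /= mirror_F0 mirror_log0 mul1r mulr0 !addr0 => ->.
by rewrite /mirror_G muln1 [harmonic 1]harmonicE big_ord1 invr1 /multinom_coef muln1 expr1n divr1.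
Qed.

Lemma zloc_harmonic_fact p N : (harmonic N - 1) * N`!%:R \in zloc p.
Proof.
rewrite mulrBl mul1r rpredB ?zloc_nat // harmonicE mulr_suml; apply: rpred_sum => i _.
have /dvdnP[q ->] : (i.+1 %| N`!)%N by rewrite dvdn_fact //= ltn_ord.
by rewrite natrM mulrC mulfK ?zloc_nat // pnatr_eq0.
Qed.

Lemma padic_val_unit p N : prime p -> (1 < N)%N -> exists2 w, w \in zloc p &
  p%:R ^ padic_val p (harmonic N - 1) = (harmonic N - 1) * w.
Proof.
move=> pp N1; have h0 : harmonic N - 1 != 0 by rewrite gt_eqF ?harmonic_sub1_gt0.
have [u [u0 up uV E]] := padic_val_decomp pp h0; exists u^-1 => //.
by rewrite -[LHS](mulfK u0) -E.
Qed.

(* The obstruction is the coefficient of [z^p] of [F(z) F(z^p)] times the defect,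
   which is, up to a unit, [N! (p h(p) - h(1))] modulo [p^4 N!]. *)
Lemma mirror_defect_exact p N (c : rat) : prime p -> (1 < N)%N -> (4 < p)%N ->
  padic_val p (harmonic N - 1) = 3 -> omega p N = 0%N -> c != 0 ->
  (forall n, fps_subst p (mirror_log N) n - p%:R * mirror_log N n \in zid p (p%:R * c)) ->
  p%:R ^+ 2 * N`!%:R / c \in zloc p.
Proof.
move=> pp N1 p4 v3 o0 c0 hD; have p0 := prime_gt0 pp.
have pR : (p%:R : rat) != 0 by rewrite pnatr_eq0 -lt0n.
have F0 : (N`!%:R : rat) != 0 by rewrite pnatr_eq0 -lt0n fact_gt0.
have x0 : p%:R ^+ 2 * N`!%:R != 0 :> rat by rewrite mulf_neq0 ?expf_neq0.
(* Otherwise [c] lies in [p^3 N! Z_(p)], which will contradict [omega p N = 0]. *)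
case/orP: (zloc_total (c / (p%:R ^+ 2 * N`!%:R)) pp); last by rewrite invf_div.
rewrite -(zid_mul2l _ _ _ x0) mulrC divfK // => hc.
have hC : ((mirror_F N : fps) * fps_subst p (mirror_F N) * mirror_defect p N) (0 + 1 * p)%N
    \in zid p (p%:R ^+ 4 * N`!%:R).
  apply: (@zid_trans _ (p%:R * c)); first by rewrite mulf_neq0.
    apply: rpred_sum => i _; apply: zidMl; first exact: zloc_mirror_FF.
    by rewrite mirror_defectE.
  have -> : p%:R ^+ 4 * N`!%:R = p%:R * (p%:R ^+ 2 * N`!%:R * p%:R) :> rat by ring.
  by apply: zidM => //; apply: zid_self.
have B1 : multinom_coef N 1 = N`!%:R by rewrite /multinom_coef muln1 expr1n divr1.
have Bp := multinom_step N 1 pp p0.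
rewrite muln0 div0n expr0 /rising big_ord0 mul1r mulr1 B1 in Bp.
set U := pratio _ _ _ in Bp; have Up : U \in zloc p by apply: zloc_pratio.
have UV : U^-1 \in zloc p by apply: zlocV_pratio.
have U0 : U != 0 by apply: contraNneq (multinom_neq0 N (0 + 1 * p)) => U0; rewrite Bp U0 mulr0.
have h3 : hdiff N 1 \in zid p (p%:R ^+ 3).
  rewrite /hdiff muln1 [harmonic 1]harmonicE big_ord1 invr1.
  by rewrite -[_ ^+ 3]/(_ ^ 3) padic_val_harmonic_sub1 // v3.
(* The unit [U] is 1 modulo [p]; with [hdiff N 1] divisible by [p^3], it may be inserted modulo
   [p^4 N!]. *)
have BB : N`!%:R * U - N`!%:R \in zid p (p%:R * N`!%:R).
  have := @multinom_dwork p N 0 0 1 pp; rewrite expn1 => /(_ p0).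
  by rewrite expr1 div0n expn0 muln1 mulfV ?multinom_neq0 // mulr1 add0n -[p in (0 + p)%N]mul1n Bp add0n B1.
have hp : p%:R * hdiff N (1 * p) - hdiff N 1 \in zid p (p%:R ^+ 4).
  have : N`!%:R * U * (p%:R * hdiff N (1 * p) - hdiff N 1) \in zid p (p%:R ^+ 4 * N`!%:R).
    move: hC; rewrite mirror_defect_coef // !big_ord_recl big_ord0 addr0 /= subnn.
    rewrite !mul0n hdiff0 multinom0 B1 !mulr0 mul1r mulr1 subr0 sub0r Bp.
    rewrite (_ : bump 0 0 = 1%N) ?subn0 // => hC.
    have -> : N`!%:R * U * (p%:R * hdiff N (1 * p) - hdiff N 1) =
       - (N`!%:R * hdiff N 1 + N`!%:R * U * - (p%:R * hdiff N (0 + 1 * p)))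
       - (N`!%:R * U - N`!%:R) * hdiff N 1 by rewrite add0n; ring.
    rewrite rpredB ?rpredN //.
    have -> : p%:R ^+ 4 * N`!%:R = (p%:R * N`!%:R) * p%:R ^+ 3 :> rat by ring.
    exact: zidM.
  rewrite -mulrA mulrC -(mulrC N`!%:R) [_ * N`!%:R]mulrC zid_mul2l // mulrC.
  exact: zid_mulrI.
have {}hp : psum p (N * 1 * p) - psum p (1 * p) \in zid p (p%:R ^+ 3).
  by move: hp; rewrite hdiff_mul // exprS zid_mul2l.
have NH : (N%:R ^+ 2 - 1) * harmonic p.-1 \in zid p (p%:R ^+ 3).
  have := rpredB hp (psum_diff N 1 pp p4); rewrite expr1n mul1r.
  by rewrite opprB addrCA subrr addr0.
have p2 : (2 < p)%N by apply: ltn_trans p4.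
move: o0; rewrite /omega wolstenholme_primeE // sqr_sub1_zid //.
case: ifP => // /negbT; rewrite negb_or => /andP[W NN] _.
case/negP: W; case/orP: (zloc_total (N%:R ^+ 2 - 1) pp) => [h|h]; first by rewrite h in NN.
apply: (@zid_mulrI _ (N%:R ^+ 2 - 1)) => //; last by rewrite mulrC.
by apply: contraNneq NN => ->; rewrite rpred0.
Qed.

(* For [p > N] the coefficient [p %/ N + 1] of the power series [G] is a unit
   at [p]. *)
Lemma mirror_defect_large p N (c : rat) : prime p -> (1 < N)%N -> (N < p)%N -> c != 0 ->
  (forall n, fps_subst p (mirror_log N) n - p%:R * mirror_log N n \in zid p (p%:R * c)) ->
  c^-1 \in zloc p.
Proof.
move=> pp N1 Np c0 hD; have p0 := prime_gt0 pp; have N0 : (0 < N)%N := ltnW N1.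
have pR : (p%:R : rat) != 0 by rewrite pnatr_eq0 -lt0n.
have L n : (n < p)%N -> mirror_log N n \in zid p c.
  move=> np; have [->|n0] := posnP n; first by rewrite mirror_log0 rpred0.
  have := hD n; rewrite /fps_subst gtnNdvd // sub0r rpredN.
  by rewrite zid_mul2l.
(* The least [a] with [N a > p]: as [p < N a < 2 p], exactly one carry occurs and [p] divides
   [multinom_coef N a] exactly once, against the [1 / p] in [hdiff N a]. *)
pose a := (p %/ N).+1.
have pE := divn_eq p N; have pm := ltn_pmod p N0.
have pm0 : (0 < p %% N)%N.
  rewrite lt0n; apply/negP => h; have : (N %| p)%N by [].
  by move/(primeP pp).2/orP => [] /eqP; lia.
have q0 : (0 < p %/ N)%N by rewrite divn_gt0 // ltnW.
have ap : (a < p)%N by rewrite /a; nia.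
have k1 : (N * a %/ p = 1)%N.
  have -> : (N * a = 1 * p + (N - p %% N))%N by rewrite /a; nia.
  by rewrite divnMDl // divn_small; lia.
have Ga : mirror_G N a \in zid p c.
  rewrite -mirror_FL fps_coefM; apply: rpred_sum => i _.
  apply: zidMl; first exact: zloc_multinom.
  by apply: L; apply: leq_ltn_trans ap; apply: leq_subr.
set D := psum p (N * (a + 0 * p)) - psum p (a + 0 * p).
have Dp : D \in zloc p by rewrite rpredB ?zloc_psum.
have GE : mirror_G N a = (p%:R * D + 1) * pratio p N a.
  have := multinom_step N 0 pp ap; rewrite mul0n addn0 muln0 k1 multinom0 mul1r expr1.
  rewrite /rising big_ord1 add0n mulr1 => Ba.
  have := hdiff_step N 0 p0 ap; rewrite -/D mul0n addn0 hdiff0 subr0 k1 big_ord1 muln0 add0n invr1 => ha.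
  by rewrite /mirror_G -/(hdiff N a) -/(multinom_coef N a) Ba -ha; ring.
have D1p : p%:R * D + 1 \notin zid p p%:R.
  apply/negP => h; have := rpredB h (zid_mulr p%:R Dp); rewrite addrAC subrr add0r.
  by rewrite zidE mul1r (negbTE (pinv_notin_zloc pp)).
have D1 : (p%:R * D + 1)^-1 \in zloc p.
  by case/orP: (zloc_total (p%:R * D + 1) pp) => // h; rewrite h in D1p.
have D0 : p%:R * D + 1 != 0 by apply: contraNneq D1p => ->; rewrite rpred0.
have U0 : pratio p N a != 0.
  by rewrite /pratio mulf_neq0 ?invr_eq0 ?expf_neq0 ?pfact_neq0.
have := Ga; rewrite zidE GE => h.
have -> : c^-1 = (p%:R * D + 1) * pratio p N a / c * (p%:R * D + 1)^-1 * (pratio p N a)^-1.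
  by field; rewrite c0 U0 D0.
have ? := zlocV_pratio N a pp.
by apply: rpredM => //; apply: rpredM.
Qed.

Lemma Omega_gt0 N : 0 < Omega N.
Proof.
apply: prodr_gt0 => q qq; rewrite exprz_gt0 // ltr0n; exact: prime_gt0.
Qed.

(** Where the exponent of [p] is the valuation of [H_N - 1], possibly negative, the product is a
    [p]-integral multiple of [(H_N - 1) N!], an integer. *)
Lemma Omega_fact_int N : (1 < N)%N -> Omega N * N`!%:R \is a Num.int.
Proof.
move=> N1; apply: zloc_all => p pp; have [w [w0 wp wV ->]] := Omega_decomp N pp.
case: leqP => pN; last by rewrite mul1r rpredM ?zloc_nat.
rewrite mulrAC rpredM // /Omega_exp; case: leP => h.
  by rewrite rpredM ?zloc_nat // -PoszD -exprnP rpredX ?zloc_nat.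
have [u up ->] := padic_val_unit pp N1.
by rewrite mulrAC rpredM // zloc_harmonic_fact.
Qed.

Lemma Omega_integral N : (1 < N)%N -> fps_integral (qtilde_pow N (Omega N * N`!%:R)^-1).
Proof.
move=> N1 n; apply: zloc_all => p pp; move: n.
have p0 := prime_gt0 pp; have pR : (p%:R : rat) != 0 by rewrite pnatr_eq0 -lt0n.
have F0 : (N`!%:R : rat) != 0 by rewrite pnatr_eq0 -lt0n fact_gt0.
apply/qtilde_pow_zloc => //; first by rewrite mulf_neq0 // gt_eqF // Omega_gt0.
have [w [w0 wp wV ->]] := Omega_decomp N pp; move=> n.
case: leqP => pN.
  have -> : p%:R * (p%:R ^ Omega_exp p N * w * N`!%:R) = p%:R ^ (1 + Omega_exp p N) * N`!%:R * w.
    by rewrite expfzDr // expr1z; move: (_ ^ Omega_exp _ _) => x; ring.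
  apply: zid_trans (mirror_log_zid_small n pp N1 pN) _; first by rewrite mulf_neq0 // expfz_neq0.
  by rewrite zidE invfM mulrA mulfV ?mul1r // mulf_neq0 // expfz_neq0.
have -> : p%:R * (1 * w * N`!%:R) = p%:R * N`!%:R * w by ring.
apply: zid_trans (mirror_log_zid_large n pp pN) _; first by rewrite mulf_neq0.
by rewrite zidE invfM mulrA mulfV ?mul1r // mulf_neq0.
Qed.

(** Maximality in the sense of divisibility, checked one prime at a time: [mirror_defect_large] for
    [p > N], [mirror_defect_exact] if the minimum is [2 + omega p N], and the coefficient of [z]
    otherwise. *)
Lemma Omega_maximal N (c : rat) : (1 < N)%N ->
  (forall p, prime p -> padic_val p (harmonic N - 1) <= 3) ->
  c != 0 -> fps_integral (qtilde_pow N c^-1) -> Omega N * N`!%:R / c \is a Num.int.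
Proof.
move=> N1 v3 c0 ci; apply: zloc_all => p pp.
have p0 := prime_gt0 pp; have pR : (p%:R : rat) != 0 by rewrite pnatr_eq0 -lt0n.
have ciz n : qtilde_pow N c^-1 n \in zloc p by have /intrP[z ->] := ci n; apply: zloc_int.
have hD := (qtilde_pow_zloc N pp c0).1 ciz.
have [w [w0 wp wV ->]] := Omega_decomp N pp.
case: leqP => pN; last first.
  by rewrite mul1r !rpredM ?zloc_nat //; apply: mirror_defect_large hD.
have -> : p%:R ^ Omega_exp p N * w * N`!%:R / c = p%:R ^ Omega_exp p N * N`!%:R / c * w.
  by move: (_ ^ Omega_exp _ _) => x; ring.
rewrite rpredM // /Omega_exp minElt; case: ltP => h.
  (* A valuation above [2 + omega p N] excludes [p = 2] and [p = 3]; being at most 3, it equals 3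
     and [omega p N = 0]. *)
  have [p2|podd] := even_prime pp.
    by move: h; rewrite p2 => h; have := padic_val2_harmonic N1; have := omega_le1 2 N; lia.
  have p2 : (2 < p)%N by rewrite odd_prime_gt2.
  have p4 : (4 < p)%N.
    rewrite ltnNge; apply/negP => p4.
    have p3 : p = 3%N by case: (p) pp podd p2 p4 => [|[|[|[|[|]]]]].
    by move: h; rewrite p3 => h; have := @padic_val3_harmonic N; rewrite -{1}p3 => /(_ pN); lia.
  have v3p := v3 _ pp.
  have o0 : omega p N = 0%N by have := omega_le1 p N; lia.
  rewrite o0 addr0 -[_ ^ 2]/(_ ^+ 2).
  by apply: mirror_defect_exact hD => //; have := omega_le1 p N; lia.
have [u up ->] := padic_val_unit pp N1.
rewrite [_ * u * _]mulrAC [_ * u / c]mulrAC rpredM // -mirror_log1 -zidE.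
have := hD 1%N; rewrite /fps_subst gtnNdvd ?prime_gt1 // sub0r rpredN.
by rewrite zid_mul2l.
Qed.

Theorem mainTheorem3
  (no_high_valuation :
     ~ exists p N : nat,
         [/\ prime p, (2 <= N)%N & 4 <= padic_val p (harmonic N - 1)])
  (N : nat) (N_ge2 : (2 <= N)%N) :
  exists u : int,
    (u%:~R : rat) = Omega N * N`!%:R /\
    is_largest_int
      (fun w : int => w != 0 /\ fps_integral (qtilde_pow N (w%:~R)^-1)) u.
Proof.
have /intrP[u uE] := Omega_fact_int N_ge2.
have u0 : 0 < u.
  by rewrite -(ltr0z rat) -uE mulr_gt0 ?Omega_gt0 // ltr0n fact_gt0.
exists u; split=> //; split.
  by rewrite gt_eqF // -uE; split=> //; apply: Omega_integral.
move=> w [w0 wi]; have [wn|wp] := leP w 0; first exact: le_trans wn (ltW u0).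
have wR : (w%:~R : rat) != 0 by rewrite intr_eq0.
have v3 p : prime p -> padic_val p (harmonic N - 1) <= 3.
  move=> pp; rewrite leNgt; apply/negP => v4; apply: no_high_valuation.
  by exists p, N; split.
have /intrP[z zE] := Omega_maximal N_ge2 v3 wR wi.
(* Every admissible [w] divides [u], so a positive one cannot exceed it. *)
have {}zE : u = z * w by apply: (@intr_inj rat); rewrite rmorphM /= -zE divfK // uE.
have z0 : 0 < z by rewrite -(pmulr_lgt0 _ wp) -zE.
by rewrite zE -[X in X <= _]mul1r ler_pM2r // -gtz0_ge1.
Qed.
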